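(* There exist absolute constants $c_1,c_2>0$ such that every set $S$ of $n\ge 3$ points in $\mathbb{R}^3$, not all on a line, contains two points $a,b$ and a collection of at least $c_1 n^{2/3}/\beta(n)$ triangles with vertices in $S$, each having $ab$ as a side, whose areas are pairwise distinct and positive; here $\beta(n)=\exp(\alpha(n)^{c_2})$ and $\alpha$ is the inverse Ackermann function.
   Context: A triangle with vertices in $S$ is an unordered triple of points of $S$. *)

(* Defs.v *)
From HB Require Import structures.
From mathcomp Require Import all_boot all_order all_algebra finmap.
From mathcomp Require Import ring reals sequences exp.

Set Implicit Arguments.
Unset Strict Implicit.
Unset Printing Implicit Defensive.

Import Order.TTheory GRing.Theory Num.Theory.

Local Open Scope fset_scope.
Local Open Scope ring_scope.

(* The Ackermann-Peter variant. Other usual variants change the diagonal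
   inverse below only by an additive constant. *)
Fixpoint ackermann (m : nat) : nat -> nat :=
  if m is m'.+1 then
    fix ack_m (n : nat) : nat :=
      if n is n'.+1 then ackermann m' (ack_m n') else ackermann m' 1
  else succn.

Lemma ackermann_gt (m n : nat) : (n < ackermann m n)%N.
Proof.
elim: m n => [//|m IHm]; elim=> [|n IHn].
  exact: leq_ltn_trans (leq0n 1) (IHm 1%N).
exact: leq_ltn_trans IHn (IHm _).
Qed.

Lemma ackermann_diag_unbounded (n : nat) :
  exists k, (n <= ackermann k k)%N.
Proof. by exists n; apply/ltnW/ackermann_gt. Qed.

Definition inverse_ackermann (n : nat) : nat :=
  ex_minn (ackermann_diag_unbounded n).

Definition beta (R : realType) (c : R) (n : nat) : R :=
  expR ((inverse_ackermann n)%:R `^ c).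

Section Geometry.
Variable R : realType.
Local Notation point := 'rV[R]_3.

Definition collinear (S : {fset point}) : Prop :=
  exists p d : point,
    d != 0 /\ forall x, x \in S -> exists t : R, x = p + t *: d.

(* The library norm `|_| on 'rV[R]_3 is the sup norm, not this one. *)
Definition euclidean_norm (v : point) : R :=
  Num.sqrt (\sum_(i < 3) v 0 i ^+ 2).

(* Indices are taken in 'I_3, i.e. modulo 3. *)
Definition cross_product (u v : point) : point :=
  \row_(i < 3) (u 0 (i + 1) * v 0 (i + 2%:R) - u 0 (i + 2%:R) * v 0 (i + 1)).

Definition area3 (x y z : point) : R :=
  euclidean_norm (cross_product (y - x) (z - x)) / 2.

Definition triangle (S T : {fset point}) : Prop := T `<=` S /\ #|` T| = 3%N.

(* The three vertices are read off in the order in which T enumerates them;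
   by area_fset3 the value does not depend on that order. *)
Definition area (T : {fset point}) : R :=
  let s := enum_fset T in area3 s`_0 s`_1 s`_2.

Lemma area3_rot (x y z : point) : area3 y z x = area3 x y z.
Proof.
rewrite /area3; congr (euclidean_norm _ / _); apply/rowP => i.
rewrite !mxE; move: (i + 1) (i + 2%:R) => j k; ring.
Qed.

Lemma area3_swap (x y z : point) : area3 x z y = area3 x y z.
Proof.
rewrite /area3 /euclidean_norm; congr (Num.sqrt _ / _).
apply: eq_bigr => i _; rewrite !mxE; move: (i + 1) (i + 2%:R) => j k; ring.
Qed.

Lemma area_fset3 (x y z : point) :
  x != y -> x != z -> y != z -> area [fset x; y; z] = area3 x y z.
Proof.
move=> xy xz yz; rewrite /area.
have us : uniq [:: x; y; z] by rewrite /= !inE negb_or xy xz yz.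
have : perm_eq (enum_fset [fset x; y; z]) [:: x; y; z].
  by apply: uniq_perm => // u; rewrite !inE -!orbA.
move: (enum_fset _) => s ps.
have := perm_size ps; case: s ps => [|a [|b [|c [|]]]] //= ps _.
have mem u : u \in [:: x; y; z] -> [\/ u = a, u = b | u = c].
  rewrite -(perm_mem ps) !inE => /or3P[]/eqP->;
    by [constructor 1 | constructor 2 | constructor 3].
have /mem xabc : x \in [:: x; y; z] by rewrite !inE eqxx.
have /mem yabc : y \in [:: x; y; z] by rewrite !inE eqxx orbT.
have /mem zabc : z \in [:: x; y; z] by rewrite !inE eqxx !orbT.
case: xabc => ?; case: yabc => ?; case: zabc => ?; subst x y z => //;
  rewrite ?eqxx // in xy xz yz.
- exact/esym/area3_swap.
- by rewrite -[LHS]area3_rot; apply: area3_swap.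
- exact/esym/area3_rot.
- exact: area3_rot.
- by rewrite [RHS]area3_swap; apply: area3_rot.
Qed.

End Geometry.

(* Main.v *)
(* For a line [ab] the area of [abx] is proportional to the distance of [x]
   from the line, so the point set lies on few cylinders around [ab] if few
   areas occur.  Fix [a] and let [b] run over representatives [B] of the lines
   through [a]; say that at most [T] cylinders occur around each axis.

   Call two points close if few of these cylinders separate them.  By Haussler's
   packing lemma, whose shatter function is bounded by Warren's theorem on sign
   patterns of quadrics, [O(r^3)] balls of radius [1/r] of all cylinders cover
   [B].  In such a ball a point is, for most axes, within [O(T/r)] levels of the
   centre; since three points lie on at most 32 cylinders with axis through [a],
   double counting of triples shows that for [r] about [T / sqrt |B|] a ball has
   [O(sqrt |B|)] points.  Hence [|B|^2 = O(T^3)].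

   A point [a] on linearly many lines exists unless a positive proportion of the
   points is collinear: the same covering, applied to pencils of lines instead
   of families of coaxial cylinders, replaces Szemeredi-Trotter.  If many points
   are collinear, a side from one of them to a point off the line suffices.
   The argument loses no factor [beta], so [c2] is arbitrary. *)
Require Import Defs.
From HB Require Import structures.
From mathcomp Require Import all_boot all_order all_algebra finmap zify ring lra.
From mathcomp Require Import boolp classical_sets reals sequences exp topology.
From mathcomp Require Import normedtype derive.

Set Implicit Arguments.
Unset Strict Implicit.
Unset Printing Implicit Defensive.

Import Order.TTheory GRing.Theory Num.Theory.
Import numFieldNormedType.Exports.

(** * The packing lemma *)

Local Open Scope nat_scope.

(** Why a ball has [O(sqrt |B|)] points: suppose that its [g] points occupy [H] levels around most
    of the [L = |B|] axes. If [g] is a large multiple of [H], such an axis sees at least about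
    [H (g / H)^3] triples on common cylinders, so [L g^3 / H^2 = O(g^3)] and [L = O(H^2)]. Choosing
    [H] as a small multiple of [sqrt L] therefore forces [g = O(H)]. With [O(r^3)] balls for [r]
    about [T / H] this gives [L = O((T / H)^3 H)], which is the exponent 2/3. The number of balls
    must be a pure power of [r]: a covering by plain random sampling would cost a power of [log r].
    Hence the sharp packing bound, which is proved by counting edges of a cube whose vertices are
    weighted by class sizes. The power 3 is the dimension of the space in which the sign patterns
    are counted. *)

Fixpoint cube_sum (s : nat) (w : seq bool -> nat) : nat :=
  if s is s'.+1 then
    cube_sum s' (fun v => w (false :: v)) + cube_sum s' (fun v => w (true :: v))
  else w [::].

(* Total weight of the edges of the [s]-cube, an edge weighing as much as its
   lighter end. *)
Fixpoint edge_weight (s : nat) (w : seq bool -> nat) : nat :=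
  if s is s'.+1 then
    cube_sum s' (fun v => minn (w (false :: v)) (w (true :: v)))
    + edge_weight s' (fun v => w (false :: v))
    + edge_weight s' (fun v => w (true :: v))
  else 0.

(** Every [u] must be realised, so the positions in [J] are automatically distinct and below [s]: a
    repeated one gives equal bits, and one out of range reads the default [false]. *)
Definition shatters (d s : nat) (w : seq bool -> nat) : Prop :=
  exists2 J : seq nat, size J = d &
    forall u : seq bool, size u = d ->
      exists v, [/\ size v = s, 0 < w v & [seq nth false v j | j <- J] = u].

Lemma leq_cube_sum s w w' :
  (forall v, size v = s -> w v <= w' v) -> cube_sum s w <= cube_sum s w'.
Proof.
elim: s w w' => [|s IHs] w w' le_w /=; first exact: le_w.
by apply: leq_add; apply: IHs => v sv; apply: le_w; rewrite /= sv.
Qed.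

Lemma eq_cube_sum s w w' :
  (forall v, size v = s -> w v = w' v) -> cube_sum s w = cube_sum s w'.
Proof.
by move=> e; apply/eqP; rewrite eqn_leq !leq_cube_sum // => v /e->.
Qed.

Lemma cube_sumD s w w' :
  cube_sum s (fun v => w v + w' v) = cube_sum s w + cube_sum s w'.
Proof.
by elim: s w w' => [|s IHs] w w' //=; rewrite !IHs addnACA.
Qed.

Lemma cube_sumM s k w : cube_sum s (fun v => k * w v) = k * cube_sum s w.
Proof. by elim: s w => [|s IHs] w //=; rewrite !IHs mulnDr. Qed.

Lemma cube_sum_big (J : Type) (I : seq J) s (w : J -> seq bool -> nat) :
  cube_sum s (fun v => \sum_(i <- I) w i v) = \sum_(i <- I) cube_sum s (w i).
Proof.
by elim: s w => [|s IHs] w //=; rewrite !IHs big_split.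
Qed.

Lemma eq_edge_weight s w w' : w =1 w' -> edge_weight s w = edge_weight s w'.
Proof.
elim: s w w' => [|s IHs] w w' e //=; congr (_ + _ + _).
- by apply: eq_cube_sum => v _; rewrite !e.
- by apply: IHs => v.
- by apply: IHs => v.
Qed.

(** On one edge, with end weights [a], [b] and [a'], [b'], the larger of the two minima is at most
    the minimum of the pointwise maxima, and the smaller one is the minimum of all four numbers. *)
Lemma edge_weight_submod s w w' :
  edge_weight s w + edge_weight s w' <=
  edge_weight s (fun v => maxn (w v) (w' v))
  + edge_weight s (fun v => minn (w v) (w' v)).
Proof.
elim: s w w' => [|s IHs] w w' //=.
have := IHs (fun v => w (false :: v)) (fun v => w' (false :: v)).
have := IHs (fun v => w (true :: v)) (fun v => w' (true :: v)).
suff : cube_sum s (fun v => minn (w (false :: v)) (w (true :: v))) +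
       cube_sum s (fun v => minn (w' (false :: v)) (w' (true :: v))) <=
       cube_sum s (fun v => minn (maxn (w (false :: v)) (w' (false :: v)))
                                 (maxn (w (true :: v)) (w' (true :: v)))) +
       cube_sum s (fun v => minn (minn (w (false :: v)) (w' (false :: v)))
                                 (minn (w (true :: v)) (w' (true :: v)))) by lia.
by rewrite -!cube_sumD; apply: leq_cube_sum => v _; lia.
Qed.

Lemma shatters_weaken d s w : shatters d.+1 s w -> shatters d s w.
Proof.
case=> [[|j J] //= [sJ]] sh; exists J => // u su.
have [v [sv wv [_ e]]] := sh (false :: u) (congr1 S su).
by exists v.
Qed.

Lemma shatters_max d s w :
  shatters d s (fun v => maxn (w (false :: v)) (w (true :: v))) ->
  shatters d s.+1 w.
Proof.
case=> J sJ sh; exists [seq j.+1 | j <- J]; first by rewrite size_map.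
move=> u /sh[v [sv]]; rewrite leq_max => /orP[] wv e;
  [exists (false :: v) | exists (true :: v)]; split; rewrite /= ?sv //;
  by rewrite -map_comp.
Qed.

Lemma shatters_min d s w :
  shatters d s (fun v => minn (w (false :: v)) (w (true :: v))) ->
  shatters d.+1 s.+1 w.
Proof.
case=> J sJ sh; exists (0 :: [seq j.+1 | j <- J]).
  by rewrite /= size_map sJ.
case=> [|b u] // [/sh[v [sv]]]; rewrite leq_min => /andP[w0 w1] e.
exists (b :: v); split; rewrite /= ?sv //; first by case: b.
by rewrite -map_comp; congr (_ :: _).
Qed.

(* Haussler's bound for the one-inclusion graph; taking maxima and minima of
   the two halves plays the role of projection and of the doubled part. *)
Lemma edge_weight_le d s w :
  ~ shatters d.+1 s w -> edge_weight s w <= d * cube_sum s w.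
Proof.
elim: s d w => [|s IHs] d w nsh //=.
set w0 := fun v => w (false :: v); set w1 := fun v => w (true :: v).
set wM := fun v => maxn (w0 v) (w1 v); set wm := fun v => minn (w0 v) (w1 v).
have sumE : cube_sum s w0 + cube_sum s w1 = cube_sum s wM + cube_sum s wm.
  by rewrite -!cube_sumD; apply: eq_cube_sum => v _; rewrite /wM /wm; lia.
have := edge_weight_submod s w0 w1; rewrite -/wM -/wm => sub.
have /IHs leM : ~ shatters d.+1 s wM by move/shatters_max.
have nshm : ~ shatters d s wm by move/shatters_min.
rewrite -addnA sumE; apply: leq_trans (_ : cube_sum s wm +
  (edge_weight s wM + edge_weight s wm) <= _); first by rewrite leq_add2l.
(* [wm] can shatter only one coordinate less, and the [cube_sum s wm] thus saved pays for the edges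
   joining the halves. For [d = 0] it shatters not even the empty set, so it vanishes. *)
suff : cube_sum s wm + edge_weight s wm <= d * cube_sum s wm by lia.
case: d nshm {leM nsh} => [|d] nshm; last by have := IHs _ _ nshm; lia.
have wm0 v : size v = s -> wm v <= 0.
  move=> sv; rewrite leqNgt; apply/negP => wv; apply: nshm.
  by exists [::] => // -[|//] _; exists v.
have c0 : cube_sum s wm = 0.
  apply/eqP; rewrite -leqn0; apply: leq_trans (leq_cube_sum wm0) _.
  by elim: {+}s => //= k; rewrite leqn0 => /eqP->.
have nsh1 : ~ shatters 1 s wm by move/shatters_weaken.
by have := IHs _ _ nsh1; rewrite c0; lia.
Qed.

(** * Packing by averaging the edge weight over samples *)

Section Packing.
Variables (X : eqType) (J : eqType) (I : seq J) (sgn : X -> J -> bool).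

Definition separation (x y : X) : nat := count (fun i => sgn x i != sgn y i) I.

Definition pattern (A : seq J) (x : X) : seq bool := [seq sgn x i | i <- A].

Definition class_size (N : seq X) (A : seq J) (v : seq bool) : nat :=
  count (fun x => pattern A x == v) N.

Definition class_count (N : seq X) (A : seq J) : nat :=
  cube_sum (size A) (fun v => 0 < class_size N A v).

(** An expectation over [s] independent uniform draws from [I], multiplied by [size I ^ s] to stay
    in [nat]. *)
Fixpoint sample_sum (s : nat) (F : seq J -> nat) : nat :=
  if s is s'.+1 then \sum_(i <- I) sample_sum s' (fun A => F (i :: A))
  else F [::].

Local Notation half N i b := [seq x <- N | sgn x i == b].

Lemma class_size_cons N i A b v :
  class_size N (i :: A) (b :: v) = class_size (half N i b) A v.
Proof.
rewrite /class_size count_filter; apply: eq_count => x /=.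
by rewrite eqseq_cons andbC.
Qed.

Lemma cube_sum_class_size N A : cube_sum (size A) (class_size N A) = size N.
Proof.
elim: A N => [|i A IHA] N /=.
  by rewrite /class_size /= -size_filter filter_predT.
rewrite !(eq_cube_sum (fun v _ => class_size_cons _ _ _ _ v)) !IHA.
rewrite !size_filter -(count_predC (fun x => sgn x i)) addnC.
by congr (_ + _); apply: eq_count => x /=; case: sgn.
Qed.

Lemma class_count_cons N i A :
  class_count N (i :: A) =
  class_count (half N i false) A + class_count (half N i true) A.
Proof.
by rewrite /class_count /=; congr (_ + _); apply: eq_cube_sum => v _;
  rewrite class_size_cons.
Qed.

Lemma leq_sample_sum s F F' :
  (forall A, size A = s -> {subset A <= I} -> F A <= F' A) ->
  sample_sum s F <= sample_sum s F'.
Proof.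
elim: s F F' => [|s IHs] F F' le_F /=; first exact: le_F.
rewrite !big_seq; apply: leq_sum => i iI; apply: IHs => A sA AI.
by apply: le_F => [|j]; rewrite /= ?sA // inE => /predU1P[->|/AI].
Qed.

Lemma eq_sample_sum s F F' :
  (forall A, size A = s -> F A = F' A) -> sample_sum s F = sample_sum s F'.
Proof.
by move=> e; apply/eqP; rewrite eqn_leq !leq_sample_sum // => A /e->.
Qed.

Lemma sample_sumD s F F' :
  sample_sum s (fun A => F A + F' A) = sample_sum s F + sample_sum s F'.
Proof.
elim: s F F' => [|s IHs] F F' //=.
by rewrite -big_split; apply: eq_bigr => i _; rewrite IHs.
Qed.

Lemma sample_sumM s k F : sample_sum s (fun A => k * F A) = k * sample_sum s F.
Proof.
by elim: s F => [|s IHs] F //=; rewrite big_distrr; apply: eq_bigr => i _.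
Qed.

Lemma sample_sum_cst s k : sample_sum s (fun=> k) = size I ^ s * k.
Proof.
elim: s => [|s IHs] /=; first by rewrite mul1n.
rewrite IHs big_const_seq count_predT iter_addn addn0 expnS.
by rewrite mulnC mulnA.
Qed.

Lemma sample_sum_big s (F : J -> seq J -> nat) :
  \sum_(i <- I) sample_sum s (F i) = sample_sum s (fun A => \sum_(i <- I) F i A).
Proof.
elim: s F => [|s IHs] F //=.
by rewrite exchange_big; apply: eq_bigr => i _; rewrite IHs.
Qed.

Variable r : nat.

Definition well_separated (N : seq X) : Prop :=
  {in N &, forall x y, x != y -> size I <= r * separation x y}.

Lemma separated_filter N (p : pred X) : well_separated N -> well_separated [seq x <- N | p x].
Proof.
move=> sepN x y; rewrite !mem_filter => /andP[_ xN] /andP[_ yN].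
exact: sepN.
Qed.

(** Count the triples of an index and an ordered pair that it separates. An index with halves of
    sizes [h0], [h1] contributes [2 * h0 * h1], at most [2 * size N * minn h0 h1]; a pair of
    distinct points contributes at least [size I / r]. The last term makes up for the diagonal. *)
Lemma separated_split_lb N : uniq N -> well_separated N ->
  size I * size N <=
  2 * r * (\sum_(i <- I) minn (size (half N i false)) (size (half N i true)))
  + size I * (0 < size N).
Proof.
move=> uN sepN; have [->|N0] := posnP (size N); first by rewrite !muln0.
have halfE i : size (half N i false) + size (half N i true) = size N.
  rewrite !size_filter -(count_predC (fun x => sgn x i)) addnC.
  by congr (_ + _); apply: eq_count => x /=; case: sgn.
have pairE i : \sum_(x <- N) \sum_(y <- N) (sgn x i != sgn y i) =
    2 * (size (half N i false) * size (half N i true)).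
  have cntE b : \sum_(y <- N) (b != sgn y i) = size (half N i (~~ b)).
    rewrite size_filter -sum1_count [RHS]big_mkcond; apply: eq_bigr => y _.
    by case: b; case: sgn.
  rewrite (eq_bigr _ (fun x _ => cntE (sgn x i))).
  rewrite (bigID (fun x => sgn x i == false)) /=.
  rewrite (eq_bigr (fun=> size (half N i true))); last by move=> x /eqP->.
  rewrite [X in _ + X = _](eq_bigr (fun=> size (half N i false))); last first.
    by move=> x; case: sgn.
  rewrite !big_const_seq !iter_addn !addn0.
  rewrite mul2n -addnn !size_filter; congr (_ + _); first by rewrite mulnC.
  by congr (_ * _); apply: eq_count => x /=; case: sgn.
have totE : \sum_(i <- I) 2 * (size (half N i false) * size (half N i true)) =
    \sum_(x <- N) \sum_(y <- N) separation x y.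
  under eq_bigr => i _ do rewrite -pairE.
  rewrite exchange_big; apply: eq_bigr => x _; rewrite exchange_big.
  apply: eq_bigr => y _; rewrite /separation -sum1_count.
  by rewrite [RHS]big_mkcond /=; apply: eq_bigr => i _; case: (_ != _).
have lb : size I * (size N * (size N).-1) <=
    r * \sum_(x <- N) \sum_(y <- N) separation x y.
  rewrite big_distrr /= mulnCA -[leqLHS]/(size N * _).
  have <- : \sum_(x <- N) size I * (size N).-1 = size N * (size I * (size N).-1).
    by rewrite big_const_seq count_predT iter_addn addn0 mulnC.
  rewrite big_seq [leqRHS]big_seq; apply: leq_sum => x xN.
  rewrite (big_rem x) //= mulnDr; apply: leq_trans (leq_addl _ _).
  rewrite big_distrr /= -(size_rem xN).
  have -> : size I * size (rem x N) = \sum_(y <- rem x N) size I.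
    by rewrite big_const_seq count_predT iter_addn addn0 mulnC.
  rewrite big_seq [leqRHS]big_seq; apply: leq_sum => y.
  rewrite mem_rem_uniq // inE => /andP[yx yN]; apply: sepN => //.
  by rewrite eq_sym.
rewrite muln1 -(@leq_pmul2r (size N)) //.
have {}lb : size I * (size N * (size N).-1) <=
   2 * r * (\sum_(i <- I) minn (size (half N i false)) (size (half N i true)))
   * size N.
  apply: leq_trans lb _; rewrite -totE [2 * r]mulnC -!mulnA leq_mul2l.
  apply/orP; right; rewrite mulnA -big_distrr /= -mulnA leq_mul2l /=.
  rewrite big_distrl /=; apply: leq_sum => i _.
  by have := halfE i; case: leqP; nia.
by move: lb; case: (size N) N0 => //= k _; nia.
Qed.

(** All [s.+1] directions of the cube contribute alike: when the other [s] draws are fixed, the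
    remaining one splits each class, and [separated_split_lb] applies to every class. Its last terms
    add up to [class_count]. *)
Lemma sample_edge_weight_lb s N : uniq N -> well_separated N ->
  s.+1 * (size I ^ s.+1 * size N) <=
  2 * r * sample_sum s.+1 (fun A => edge_weight s.+1 (class_size N A))
  + s.+1 * size I * sample_sum s (class_count N).
Proof.
elim: s N => [|s IHs] N uN sepN.
  have := separated_split_lb uN sepN.
  rewrite !mul1n expn1 /= /class_count /= /class_size /=.
  rewrite -size_filter filter_predT.
  under [X in _ <= _ * X + _ -> _]eq_bigr => i _.
    rewrite !size_filter; over.
  move/leq_trans; apply; rewrite leq_add2r leq_mul2l; apply/orP; right.
  apply: leq_sum => i _; rewrite !addn0; apply: eq_leq.
  by congr (minn _ _); apply: eq_count => x; rewrite /= eqseq_cons andbT.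
pose top i := sample_sum s.+1 (fun A => cube_sum s.+1 (fun v =>
  minn (class_size N (i :: A) (false :: v)) (class_size N (i :: A) (true :: v)))).
pose sub i := sample_sum s.+1 (fun A => edge_weight s.+1 (class_size (half N i false) A))
  + sample_sum s.+1 (fun A => edge_weight s.+1 (class_size (half N i true) A)).
pose cls i := sample_sum s (fun A => class_count N (i :: A)).
(* The first direction: its index is moved to the innermost sum, as if it were drawn after the
   classes are fixed. *)
have le_top : size I ^ s.+2 * size N <=
    2 * r * (\sum_(i <- I) top i) + size I * \sum_(i <- I) cls i.
  rewrite -[\sum_(i <- I) cls i]/(sample_sum s.+1 (class_count N)).
  rewrite sample_sum_big -!sample_sumM -sample_sumD.
  rewrite expnSr -mulnA -sample_sum_cst.
  apply: leq_sample_sum => A sA _.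
  rewrite /class_count sA -cube_sum_big -!cube_sumM -cube_sumD.
  rewrite -[in leqLHS](cube_sum_class_size N A) sA -cube_sumM.
  apply: leq_cube_sum => v sv.
  pose Nv := [seq x <- N | pattern A x == v].
  have szE M : class_size M A v = size [seq x <- M | pattern A x == v].
    by rewrite size_filter.
  have halfE i b : class_size N (i :: A) (b :: v) = size (half Nv i b).
    rewrite class_size_cons szE !size_filter !count_filter.
    by apply: eq_count => x /=; rewrite andbC.
  rewrite szE; under eq_bigr => i _ do rewrite !halfE.
  exact: (separated_split_lb (filter_uniq _ uN) (separated_filter sepN)).
have splitE : sample_sum s.+2 (fun A => edge_weight s.+2 (class_size N A)) =
    \sum_(i <- I) top i + \sum_(i <- I) sub i.
  transitivity (\sum_(i <- I) (top i + sub i)); last by rewrite big_split.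
  apply: eq_bigr => i _; rewrite /top /sub -!sample_sumD.
  rewrite -[LHS]/(sample_sum s.+1 (fun A => edge_weight s.+2 (class_size N (i :: A)))).
  apply: eq_sample_sum => A sA.
  have ext b : (fun v => class_size N (i :: A) (b :: v)) =1
      class_size (half N i b) A by move=> v; rewrite class_size_cons.
  rewrite -(eq_edge_weight s.+1 (ext false)) -(eq_edge_weight s.+1 (ext true)).
  by rewrite addnA.
(* The other directions lie within the two halves cut out by [i], where induction applies. *)
have rec i : s.+1 * (size I ^ s.+1 * size N) <=
   2 * r * sub i + s.+1 * size I * cls i.
  have := IHs _ (filter_uniq (fun x => sgn x i == false) uN) (separated_filter sepN).
  have := IHs _ (filter_uniq (fun x => sgn x i == true) uN) (separated_filter sepN).
  rewrite /cls (eq_sample_sum (fun A _ => class_count_cons N i A)) sample_sumD /sub.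
  have : size (half N i false) + size (half N i true) = size N.
    rewrite !size_filter -(count_predC (fun x => sgn x i)) addnC.
    by congr (_ + _); apply: eq_count => x /=; case: sgn.
  by move=> <-; rewrite !mulnDr; lia.
have recsum : size I * (s.+1 * (size I ^ s.+1 * size N)) <=
    2 * r * (\sum_(i <- I) sub i) + s.+1 * size I * \sum_(i <- I) cls i.
  rewrite !big_distrr -big_split /=.
  apply: leq_trans (leq_sum _ (fun i _ => rec i)).
  by rewrite big_const_seq count_predT iter_addn addn0 mulnC.
rewrite splitE -[sample_sum s.+1 (class_count N)]/(\sum_(i <- I) cls i).
move: le_top recsum; rewrite [size I ^ s.+2]expnS {splitE rec}.
move: (\sum_(i <- I) top i) (\sum_(i <- I) sub i) (\sum_(i <- I) cls i).
by move: (size I ^ s.+1) => q x y z; nia.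
Qed.

(** With [s.+1 = 4 * d * r] the edge term, on average at most [2 * r * d * size N], is half of
    [s.+1 * size N]; the other half has to come from the at most [K] classes. *)
Lemma packing_bound d s K N : 0 < size I -> 0 < d ->
    uniq N -> well_separated N -> s.+1 = 4 * d * r ->
    (forall A, {subset A <= I} -> ~ shatters d.+1 (size A) (class_size N A)) ->
    (forall A, size A = s -> {subset A <= I} -> class_count N A <= K) ->
  size N <= 2 * K.
Proof.
move=> I0 d0 uN sepN sE nsh leK.
have := sample_edge_weight_lb s uN sepN.
have ub : sample_sum s.+1 (fun A => edge_weight s.+1 (class_size N A)) <=
    size I ^ s.+1 * (d * size N).
  rewrite -sample_sum_cst; apply: leq_sample_sum => A sA AI.
  by rewrite -[in leqRHS](cube_sum_class_size N A) -sA; apply/edge_weight_le/nsh.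
have ub' : sample_sum s (class_count N) <= size I ^ s * K.
  by rewrite -sample_sum_cst; apply: leq_sample_sum => A sA AI; apply: leK.
move=> lb; have r0 : 0 < r by case: (r) sE => //; rewrite muln0.
have {}lb : s.+1 * (size I ^ s.+1 * size N) <=
   2 * r * (size I ^ s.+1 * (d * size N)) + s.+1 * size I * (size I ^ s * K).
  by apply: leq_trans lb _; apply: leq_add; rewrite leq_mul2l ?ub ?ub' orbT.
have e : s.+1 * size I * (size I ^ s * K) = s.+1 * (size I ^ s.+1 * K).
  by rewrite expnS; nia.
move: lb; rewrite e sE.
have q0 : 0 < size I ^ s.+1 by rewrite expn_gt0 I0.
move: (size I ^ s.+1) q0 => q q0 lb.
have dr0 : 0 < 2 * d * r * q by rewrite !muln_gt0 d0 r0.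
have {}lb : (2 * d * r * q) * size N <= (2 * d * r * q) * (2 * K) by nia.
by rewrite leq_pmul2l in lb.
Qed.

Lemma maximal_separated (N : seq X) : exists Z : seq X,
  [/\ uniq Z, {subset Z <= N}, well_separated Z &
      forall x, x \in N -> exists2 c, c \in Z & r * separation x c <= size I].
Proof.
elim: N => [|x N [Z [uZ ZN sepZ cov]]]; first by exists [::].
have sepC y z : separation y z = separation z y.
  by apply: eq_count => i; rewrite eq_sym.
have sepxx : separation x x = 0.
  by rewrite /separation (eq_count (a2 := pred0)) ?count_pred0 // => i; rewrite /= eqxx.
have [/hasP[c cZ cx]|/hasPn far] :=
  boolP (has (fun c => r * separation x c <= size I) Z).
  exists Z; split=> //= y; first by rewrite inE => /ZN->; rewrite orbT.
  by rewrite inE => /predU1P[->|/cov //]; exists c.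
exists (x :: Z); split=> /=.
- rewrite uZ andbT; apply/negP => /far.
  by rewrite sepxx muln0.
- by move=> y; rewrite !inE => /predU1P[->|/ZN->]; rewrite ?eqxx ?orbT.
- move=> y z; rewrite !inE => /predU1P[->|yZ] /predU1P[->|zZ].
  + by rewrite eqxx.
  + by have := far _ zZ; rewrite -ltnNge => /ltnW.
  + by have := far _ yZ; rewrite -ltnNge sepC => /ltnW.
  + exact: sepZ.
- move=> y; rewrite inE => /predU1P[->|/cov[c cZ cy]].
    by exists x; rewrite ?mem_head // sepxx muln0.
  by exists c; rewrite // inE cZ orbT.
Qed.

End Packing.

(** * Polynomial functions and sign patterns *)

Local Open Scope ring_scope.

Section PolyFun.
Variables (R : realType) (n : nat).
Local Notation pt := 'rV[R]_n.

(** Functions with a degree bound rather than formal polynomials: the arguments go by induction on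
    how a function is built and need no normal form in several variables. *)
Inductive poly_fun : nat -> (pt -> R) -> Prop :=
| poly_fun_cst c : poly_fun 0 (fun=> c)
| poly_funS d f : poly_fun d f -> poly_fun d.+1 f
| poly_funD d f g :
    poly_fun d f -> poly_fun d g -> poly_fun d (fun x => f x + g x)
| poly_fun_mulX d f i : poly_fun d f -> poly_fun d.+1 (fun x => x 0 i * f x)
| poly_fun_ext d f g : f =1 g -> poly_fun d f -> poly_fun d g.

Lemma poly_fun_le d e f : (d <= e)%N -> poly_fun d f -> poly_fun e f.
Proof.
move=> /subnK<- pf; elim: (e - d)%N => [|k] //.
by rewrite addSn; apply: poly_funS.
Qed.

Lemma poly_fun_const d c : poly_fun d (fun=> c).
Proof. exact: poly_fun_le (leq0n d) (poly_fun_cst c). Qed.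

Lemma poly_funZ d f c : poly_fun d f -> poly_fun d (fun x => c * f x).
Proof.
elim=> {d f}.
- by move=> c'; apply: poly_fun_cst.
- by move=> d f _; apply: poly_funS.
- move=> d f g _ IHf _ IHg; apply: poly_fun_ext (poly_funD IHf IHg) => x.
  by rewrite mulrDr.
- move=> d f i _ IHf; apply: poly_fun_ext (poly_fun_mulX i IHf) => x.
  by rewrite mulrCA.
- by move=> d f g e _; apply: poly_fun_ext => x; rewrite e.
Qed.

Lemma poly_funM d e f g :
  poly_fun d f -> poly_fun e g -> poly_fun (d + e) (fun x => f x * g x).
Proof.
move=> pf pg; elim: pf => {d f}.
- by move=> c; apply: poly_funZ.
- by move=> d f _; apply: poly_funS.
- move=> d f f' _ IHf _ IHf'; apply: poly_fun_ext (poly_funD IHf IHf') => x.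
  by rewrite mulrDl.
- move=> d f i _ IHf; apply: poly_fun_ext (poly_fun_mulX i IHf) => x.
  by rewrite mulrA.
- by move=> d f f' e' _; apply: poly_fun_ext => x; rewrite e'.
Qed.

Lemma poly_funX i : poly_fun 1 (fun x => x 0 i).
Proof.
by apply: poly_fun_ext (poly_fun_mulX i (poly_fun_cst 1)) => x; rewrite mulr1.
Qed.

Lemma poly_fun_exp d f k : poly_fun d f -> poly_fun (k * d) (fun x => f x ^+ k).
Proof.
move=> pf; elim: k => [|k IHk].
  by apply: poly_fun_ext (poly_fun_cst 1) => x; rewrite expr0.
by apply: poly_fun_ext (poly_funM pf IHk) => x; rewrite exprS.
Qed.

Lemma poly_fun_prod (J : Type) (A : seq J) d (f : J -> pt -> R) :
  (forall j, poly_fun d (f j)) ->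
  poly_fun (size A * d) (fun x => \prod_(j <- A) f j x).
Proof.
move=> pf; elim: A => [|j A IHA].
  by apply: poly_fun_ext (poly_fun_cst 1) => x; rewrite big_nil.
by apply: poly_fun_ext (poly_funM (pf j) IHA) => x; rewrite big_cons.
Qed.

Lemma poly_fun_sum (J : Type) (A : seq J) d (f : J -> pt -> R) :
  (forall j, poly_fun d (f j)) -> poly_fun d (fun x => \sum_(j <- A) f j x).
Proof.
move=> pf; elim: A => [|j A IHA].
  by apply: poly_fun_ext (poly_fun_const d 0) => x; rewrite big_nil.
by apply: poly_fun_ext (poly_funD (pf j) IHA) => x; rewrite big_cons.
Qed.

Lemma poly_fun_continuous d f : poly_fun d f -> continuous f.
Proof.
elim=> {d f}.
- by move=> c; apply: cst_continuous.
- by [].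
- by move=> d f g _ cf _ cg x; apply: continuousD; [apply: cf|apply: cg].
- move=> d f i _ cf x; apply: continuousM; last exact: cf.
  exact: coord_continuous.
- by move=> d f g e _; rewrite (funext e).
Qed.

Lemma poly_fun_growth d f : poly_fun d f ->
  exists2 C, 0 <= C & forall (x : pt) rho, 1 <= rho ->
    (forall i, `|x 0 i| <= rho) -> `|f x| <= C * rho ^+ d.
Proof.
elim=> {d f}.
- by move=> c; exists `|c| => // x rho _ _; rewrite expr0 mulr1.
- move=> d f _ [C C0 fC]; exists C => // x rho rho1 xr.
  apply: le_trans (fC _ _ rho1 xr) _; apply: ler_wpM2l => //.
  by rewrite exprS ler_peMl // exprn_ge0 // (le_trans ler01).
- move=> d f g _ [C C0 fC] _ [C' C0' gC]; exists (C + C'); first exact: addr_ge0.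
  move=> x rho rho1 xr; rewrite mulrDl; apply: le_trans (ler_normD _ _) _.
  by apply: lerD; [apply: fC|apply: gC].
- move=> d f i _ [C C0 fC]; exists C => // x rho rho1 xr.
  by rewrite normrM exprS mulrCA; apply: ler_pM => //; apply: fC.
- move=> d f g e _ [C C0 fC]; exists C => // x rho rho1 xr.
  by rewrite -e; apply: fC.
Qed.

Local Notation dir i := (delta_mx 0 i : pt).

(** A quadratic remainder replaces differentiability. The clause for [d = 0] serves the product
    rule: there [d.-1] is no smaller than [d], and [x 0 j * g x] must still have degree 0. *)
Lemma poly_fun_deriv d f i : poly_fun d f ->
  exists g, [/\ poly_fun d.-1 g, (d = 0%N -> g =1 fun=> 0) &
    forall x, exists2 C, 0 <= C & forall t, `|t| <= 1 ->
      `|f (x + t *: dir i) - f x - t * g x| <= C * t ^+ 2].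
Proof.
elim=> {d f}.
- move=> c; exists (fun=> 0); split=> //; first exact: poly_fun_cst.
  by move=> x; exists 0 => // t _; rewrite subrr mulr0 subr0 normr0 mul0r.
- move=> d f _ [g [pg g0 gC]]; exists g; split=> //=.
  exact: poly_fun_le (leq_pred d) pg.
- move=> d f f' _ [g [pg g0 gC]] _ [g' [pg' g0' gC']].
  exists (fun x => g x + g' x); split; first exact: poly_funD.
    by move=> d0 x; rewrite g0 // g0' // addr0.
  move=> x; have [C C0 fC] := gC x; have [C' C0' fC'] := gC' x.
  exists (C + C'); first exact: addr_ge0.
  move=> t t1; rewrite mulrDl.
  apply: le_trans (lerD (fC t t1) (fC' t t1)); apply: le_trans (ler_normD _ _).
  by rewrite le_eqVlt; apply/orP; left; apply/eqP; congr (`| _ |); ring.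
- move=> d f j pf [g [pg g0 gC]].
  exists (fun x => (j == i)%:R * f x + x 0 j * g x); split=> //=.
  + apply: poly_funD; first exact: poly_funZ.
    case: d pg g0 pf gC => [|d] pg g0 pf gC; last exact: poly_fun_mulX.
    by apply: poly_fun_ext (poly_fun_cst 0) => x; rewrite g0 // mulr0.
  + move=> x; have [C C0 fC] := gC x.
    exists (`|x 0 j| * C + (`|g x| + C)); first by rewrite !addr_ge0 // mulr_ge0.
    move=> t t1; have {}fC := fC t t1.
    have t2 : `|t| ^+ 2 = t ^+ 2 by rewrite -normrX ger0_norm // sqr_ge0.
    have lip : `|f (x + t *: dir i) - f x| <= `|t| * (`|g x| + C).
      have -> : f (x + t *: dir i) - f x =
          (f (x + t *: dir i) - f x - t * g x) + t * g x by ring.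
      apply: le_trans (ler_normD _ _) _; rewrite normrM mulrDr addrC lerD2l.
      apply: le_trans fC _; rewrite -t2 mulrC expr2 -mulrA.
      by apply: ler_wpM2l => //; rewrite ler_piMl.
    have -> : (x + t *: dir i) 0 j * f (x + t *: dir i) - x 0 j * f x
        - t * ((j == i)%:R * f x + x 0 j * g x) =
        x 0 j * (f (x + t *: dir i) - f x - t * g x)
        + (j == i)%:R * (t * (f (x + t *: dir i) - f x)).
      by rewrite !mxE eqxx /=; ring.
    apply: le_trans (ler_normD _ _) _; rewrite mulrDl; apply: lerD.
      by rewrite normrM -mulrA; apply: ler_wpM2l.
    rewrite normrM; apply: le_trans (_ : `|t * (f (x + t *: dir i) - f x)| <= _).
      by rewrite ler_piMl // normr_nat lern1; case: (j == i).
    by rewrite normrM mulrC -t2 expr2 [leRHS]mulrC -mulrA mulrC ler_wpM2l.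
- move=> d f f' e _ [g [pg g0 gC]]; exists g; split=> // x.
  by have [C C0 fC] := gC x; exists C => // t t1; rewrite -!e; apply: fC.
Qed.
End PolyFun.

(** * Common zeros of equations [x_i ^ q = h_i] with [deg h_i < q] *)

Section Reduction.
Variables (R : realType) (n q : nat).
Local Notation pt := 'rV[R]_n.
Variables (zs : seq pt) (h : 'I_n -> pt -> R).
Hypothesis q_gt0 : (0 < q)%N.
Hypothesis poly_h : forall i, poly_fun q.-1 (h i).
Hypothesis zs_pow : forall i z, z \in zs -> z 0 i ^+ q = h i z.

Local Notation expt := {ffun 'I_n -> 'I_q}.
Definition monomial (al : expt) (x : pt) : R := \prod_(i < n) x 0 i ^+ al i.

Definition mdegree (al : expt) : nat := (\sum_(i < n) al i)%N.

Definition reducible (d : nat) (f : pt -> R) : Prop :=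
  exists2 c : expt -> R, (forall al, (d < mdegree al)%N -> c al = 0) &
    {in zs, forall z, f z = \sum_al c al * monomial al z}.

Lemma reducible_le d e f : (d <= e)%N -> reducible d f -> reducible e f.
Proof.
move=> de [c c0 fE]; exists c => // al /(leq_ltn_trans de); exact: c0.
Qed.

Lemma reducible_eq d f g :
  {in zs, f =1 g} -> reducible d f -> reducible d g.
Proof. by move=> fg [c c0 fE]; exists c => // z zz; rewrite -fg // fE. Qed.

Lemma reducible0 d : reducible d (fun=> 0).
Proof.
by exists (fun=> 0) => // z _; rewrite big1 // => al _; rewrite mul0r.
Qed.

Lemma reducibleD d f g :
  reducible d f -> reducible d g -> reducible d (fun x => f x + g x).
Proof.
move=> [c c0 fE] [c' c0' gE]; exists (fun al => c al + c' al) => [al dal|z zz].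
  by rewrite c0 // c0' // addr0.
by rewrite fE // gE // -big_split; apply: eq_bigr => al _; rewrite mulrDl.
Qed.

Lemma reducibleZ d f a : reducible d f -> reducible d (fun x => a * f x).
Proof.
move=> [c c0 fE]; exists (fun al => a * c al) => [al dal|z zz].
  by rewrite c0 // mulr0.
by rewrite fE // big_distrr; apply: eq_bigr => al _; rewrite /= mulrA.
Qed.

Lemma reducible_sum (J : Type) (A : seq J) d (f : J -> pt -> R) :
  (forall j, reducible d (f j)) -> reducible d (fun x => \sum_(j <- A) f j x).
Proof.
move=> rf; elim: A => [|j A IHA].
  by apply: reducible_eq (reducible0 d) => x _; rewrite big_nil.
by apply: reducible_eq (reducibleD (rf j) IHA) => x _; rewrite big_cons.
Qed.

Lemma reducible_monomial d al : (mdegree al <= d)%N -> reducible d (monomial al).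
Proof.
move=> dal; exists (fun be => (be == al)%:R) => [be|z _].
  by case: eqP => // ->; rewrite ltnNge dal.
rewrite (bigD1 al) //= eqxx mul1r big1 ?addr0 // => be /negbTE->.
by rewrite mul0r.
Qed.

Lemma poly_fun_monomial_drop (al : expt) i :
  poly_fun (mdegree al - al i) (fun x : pt => \prod_(j < n | j != i) x 0 j ^+ al j).
Proof.
rewrite /mdegree (bigD1 i) //= addKn.
elim: (index_enum _) => [|j A IHA].
  by apply: poly_fun_ext (@poly_fun_const R n _ 1) => x; rewrite big_nil.
have [ji|ji] := boolP (j != i); last first.
  rewrite big_cons (negbTE ji).
  by apply: poly_fun_ext IHA => x; rewrite big_cons (negbTE ji).
rewrite big_cons ji.
have pj : poly_fun (al j) (fun x : pt => x 0 j ^+ al j).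
  by rewrite -[X in poly_fun X]muln1; apply: poly_fun_exp; apply: poly_funX.
by apply: poly_fun_ext (poly_funM pj IHA) => x; rewrite big_cons ji.
Qed.

(** Multiplying a monomial by [x_i] leaves the range of exponents only by producing [x_i ^ q].
    Replacing that power by [h i] lowers the total degree, which is why [reducible] keeps track of
    degrees and the outer induction is on [d]. *)
Lemma poly_fun_reducible d f : poly_fun d f -> reducible d f.
Proof.
elim/ltn_ind: d f => d IHd f pf.
elim: pf IHd => {d f}.
- move=> c IHd; pose o : expt := [ffun=> Ordinal q_gt0].
  have o0 : mdegree o = 0%N by rewrite /mdegree big1 // => i _; rewrite ffunE.
  have /(reducibleZ c) : reducible 0 (monomial o).
    by apply: reducible_monomial; rewrite o0.
  apply: reducible_eq => x _; rewrite /monomial big1 ?mulr1 // => i _.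
  by rewrite ffunE expr0.
- by move=> d f pf _ IHd; apply: reducible_le (leqnSn d) (IHd _ _ _ pf).
- move=> d f g _ IHf _ IHg IHd.
  by apply: reducibleD; [apply: IHf|apply: IHg] => e; apply: IHd.
- move=> d f i pf _ IHd; have [c c0 fE] := IHd d (ltnSn d) f pf.
  suff : reducible d.+1 (fun x => \sum_al c al * (x 0 i * monomial al x)).
    apply: reducible_eq => z zz; rewrite fE // big_distrr; apply: eq_bigr => al _.
    exact: mulrCA.
  apply: reducible_sum => al.
  have [dal|/c0->] := leqP (mdegree al) d; last first.
    by apply: reducible_eq (reducible0 _) => x _; rewrite mul0r.
  apply: reducibleZ.
  have monoE x : monomial al x =
      x 0 i ^+ al i * \prod_(j < n | j != i) x 0 j ^+ al j.
    by rewrite /monomial (bigD1 i).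
  have [aq|aq] := ltnP (al i).+1 q.
    pose be : expt := [ffun j => if j == i then Ordinal aq else al j].
    have dbe : mdegree be = (mdegree al).+1.
      rewrite /mdegree (bigD1 i) //= [in RHS](bigD1 i) //= ffunE eqxx /= addSn.
      by congr (_ + _).+1; apply: eq_bigr => j /negbTE ji; rewrite ffunE ji.
    have /reducible_monomial : (mdegree be <= d.+1)%N by rewrite dbe.
    apply: reducible_eq => x _; rewrite monoE mulrA -exprS /monomial (bigD1 i) //=.
    rewrite ffunE eqxx; congr (_ * _); apply: eq_bigr => j /negbTE ji.
    by rewrite ffunE ji.
  have aE : (al i).+1 = q by apply/eqP; rewrite eqn_leq aq ltn_ord.
  have le_al : (al i <= mdegree al)%N by rewrite /mdegree (bigD1 i) // leq_addr.
  have := poly_funM (poly_h i) (poly_fun_monomial_drop al i).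
  rewrite -[X in (X.-1 + _)%N]aE /= subnKC // => pg.
  apply: (@reducible_le d) => //.
  apply: reducible_eq (IHd d (ltnSn d) _ (poly_fun_le dal pg)) => z zz.
  by rewrite monoE -zs_pow // mulrA -exprS aE.
- move=> d f g e _ IHf IHd; apply: reducible_eq (IHf IHd) => x _; exact: e.
Qed.

(** A case of Bezout by linear algebra: restricted to [zs], polynomial functions lie in the span of
    the [q ^ n] monomials with exponents below [q], yet they include the indicator of each point. *)
Lemma common_zeros_le : uniq zs -> (size zs <= q ^ n)%N.
Proof.
move=> uzs.
pose z (j : 'I_(size zs)) : pt := tnth (in_tuple zs) j.
have z_in j : z j \in zs by apply: mem_tnth.
have z_inj : injective z by apply/tuple_uniqP.
have interp (j0 : 'I_(size zs)) : exists c : expt -> R,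
    forall j, \sum_al c al * monomial al (z j) = (j == j0)%:R.
  have sep j : exists d, exists2 f : pt -> R, poly_fun d f &
      f (z j0) = 1 /\ (j != j0 -> f (z j) = 0).
    have [->|jj0] := eqVneq j j0.
      by exists 0%N, (fun=> 1); [apply: poly_fun_cst|].
    have /rV0Pn[i] : z j0 - z j != 0.
      by rewrite subr_eq0 eq_sym; apply: contra_neq jj0 => /z_inj.
    rewrite !mxE => nz.
    exists 1%N, (fun x => (z j0 0 i - z j 0 i)^-1 * (x 0 i + - z j 0 i)).
      by apply/poly_funZ/poly_funD; [apply: poly_funX|apply: poly_fun_const].
    by rewrite subrr mulr0 mulVf.
  have [d [f pf [f0 f1]]] : exists d, exists2 f : pt -> R, poly_fun d f &
      f (z j0) = 1 /\ forall j, j \in enum 'I_(size zs) -> j != j0 -> f (z j) = 0.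
    elim: (enum _) => [|j A [d [f pf [f0 f1]]]].
      by exists 0%N, (fun=> 1); [apply: poly_fun_cst|].
    have [e [g pg [g0 g1]]] := sep j.
    exists (d + e)%N, (fun x => f x * g x); first exact: poly_funM.
    split=> [|k]; first by rewrite f0 g0 mulr1.
    rewrite inE => /predU1P[->|kA] kj; first by rewrite g1 // mulr0.
    by rewrite f1 // mul0r.
  have [c _ cE] := poly_fun_reducible pf.
  exists c => j; rewrite -cE //; have [->|jj0] := eqVneq j j0; first exact: f0.
  by rewrite f1 // mem_enum.
have [c cE] := choice interp.
pose E : 'M[R]_(#|{: expt}|, size zs) := \matrix_(k, j) monomial (enum_val k) (z j).
pose B : 'M[R]_(size zs, #|{: expt}|) := \matrix_(j, k) c j (enum_val k).
have BE : B *m E = 1%:M.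
  apply/matrixP => j0 j; rewrite !mxE eq_sym -cE.
  rewrite (reindex (@enum_val _ (mem {: expt}))) /=; last first.
    by exists enum_rank => k _; rewrite ?enum_valK ?enum_rankK.
  by apply: eq_big => k; rewrite ?inE ?mxE.
have /eqP rE : row_full E by apply/row_fullP; exists B.
by rewrite -rE; apply: leq_trans (rank_leq_row E) _; rewrite card_ffun !card_ord.
Qed.
End Reduction.

(** * Warren's bound on sign patterns *)

Section SignPatterns.
Variables (R : realType) (n : nat).
Local Notation pt := 'rV[R]_n.
Local Notation dir i := (delta_mx 0 i : pt).

(** Here the derivative must be explicit: it supplies the leading power in the equations for a
    critical point. *)
Lemma exprD_taylor (a : R) D : exists2 C, 0 <= C & forall t, `|t| <= 1 ->
  `|(a + t) ^+ D - a ^+ D - t * (D%:R * a ^+ D.-1)| <= C * t ^+ 2.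
Proof.
elim: D => [|D [C C0 IH]].
  by exists 0 => // t _; rewrite !expr0 subrr mul0r mulr0 subr0 normr0 mul0r.
exists ((`|a| + 1) * C + D%:R * `|a| ^+ D.-1).
  by rewrite addr_ge0 ?mulr_ge0 ?addr_ge0 ?exprn_ge0.
move=> t t1.
have e : D%:R * (a * a ^+ D.-1) = D%:R * a ^+ D :> R.
  by case: D {IH} => [|D]; rewrite ?mul0r // -exprS.
have -> : (a + t) ^+ D.+1 - a ^+ D.+1 - t * (D.+1%:R * a ^+ D.+1.-1) =
  (a + t) * ((a + t) ^+ D - a ^+ D - t * (D%:R * a ^+ D.-1))
  + D%:R * a ^+ D.-1 * t ^+ 2 + t * (D%:R * (a * a ^+ D.-1) - D%:R * a ^+ D).
  by rewrite -natr1 !exprS /=; ring.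
rewrite e subrr mulr0 addr0 [leRHS]mulrDl; apply: le_trans (ler_normD _ _) _.
apply: lerD; last by rewrite 2!normrM normrX normr_nat (ger0_norm (sqr_ge0 t)).
rewrite normrM -mulrA; apply: ler_pM => //; last exact: IH.
by apply: le_trans (ler_normD _ _) _; rewrite lerD2l.
Qed.

Lemma local_min_slope0 (s C tau : R) : 0 < tau -> 0 <= C ->
  (forall t, `|t| < tau -> `|t| <= 1 -> 0 <= t * s + C * t ^+ 2) -> s = 0.
Proof.
move=> tau0 C0 pos; apply/eqP/negP => /negP s0.
pose m := Num.min (tau / 2) 1.
have m0 : 0 < m by rewrite lt_min divr_gt0 // ltr01.
(* The test value will be [t = - (s * k)]: the first bound on [k] keeps it in range, the second
   makes [s ^ 2 * k * (k * C - 1)] negative. *)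
pose k := Num.min (m / `|s|) (C + 1)^-1.
have C1 : 0 < C + 1 by rewrite ltr_wpDl.
have k0 : 0 < k by rewrite lt_min divr_gt0 ?normr_gt0 // invr_gt0.
have km : k <= m / `|s| by rewrite ge_min lexx.
have kC : k <= (C + 1)^-1 by rewrite ge_min lexx orbT.
have ksm : `|- (s * k)| <= m.
  rewrite normrN normrM [ `|k| ]gtr0_norm // mulrC.
  by rewrite -ler_pdivlMr ?normr_gt0.
have mt : m < tau.
  by apply: le_lt_trans (_ : tau / 2 < tau); [rewrite ge_min lexx | lra].
have m1 : m <= 1 by rewrite ge_min lexx orbT.
have := pos (- (s * k)) (le_lt_trans ksm mt) (le_trans ksm m1).
have kC1 : k * (C + 1) <= 1 by rewrite -ler_pdivlMr // div1r.
have s2 : 0 < s ^+ 2 by rewrite exprn_even_gt0.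
have -> : - (s * k) * s + C * (- (s * k)) ^+ 2 = (s ^+ 2 * k) * (k * C - 1) by ring.
by rewrite (pmulr_rge0 _ (mulr_gt0 s2 k0)) => ?; lra.
Qed.

Lemma poly_fun_stays_pos d (f : pt -> R) i y : poly_fun d f -> 0 < f y ->
  exists2 tau, 0 < tau & forall t, `|t| < tau -> 0 < f (y + t *: dir i).
Proof.
move=> pf fy; have [g [_ _ /(_ y)[C C0 fC]]] := poly_fun_deriv i pf.
pose K := `|g y| + C + 1.
have K0 : 0 < K by rewrite ltr_wpDl // addr_ge0.
exists (Num.min 1 (f y / K)); first by rewrite lt_min ltr01 divr_gt0.
move=> t; rewrite lt_min => /andP[t1 tK].
have {}fC := fC t (ltW t1).
have tK' : `|t| * K < f y by rewrite -ltr_pdivlMr.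
have : `|f (y + t *: dir i) - f y| <= `|t| * (`|g y| + C).
  have -> : f (y + t *: dir i) - f y =
      (f (y + t *: dir i) - f y - t * g y) + t * g y by ring.
  apply: le_trans (ler_normD _ _) _; rewrite normrM mulrDr addrC lerD2l.
  apply: le_trans fC _.
  have -> : t ^+ 2 = `|t| * `|t| by rewrite -expr2 real_normK ?num_real.
  by rewrite mulrC -mulrA; apply: ler_wpM2l => //; rewrite ler_piMl // ltW.
rewrite ler_norml => /andP[lo _].
have : 0 <= `|t| by []. rewrite /K in tK'; lra.
Qed.

Lemma poly_funs_stay_pos (J : Type) (A : seq J) (f : J -> pt -> R) i y :
    (forall j, exists d, poly_fun d (f j)) -> all (fun j => 0 < f j y) A ->
  exists2 tau, 0 < tau &
    forall t, `|t| < tau -> all (fun j => 0 < f j (y + t *: dir i)) A.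
Proof.
move=> pf; elim: A => [|j A IHA] /=; first by exists 1.
move=> /andP[fj /IHA[tau tau0 pos]]; have [d pfj] := pf j.
have [tau' tau0' pos'] := poly_fun_stays_pos i pfj fj.
exists (Num.min tau tau'); first by rewrite lt_min tau0.
by move=> t; rewrite lt_min => /andP[t1 t2]; rewrite pos' ?pos.
Qed.

Lemma closed_nonneg (J : Type) (A : seq J) (f : J -> pt -> R) :
  (forall j, continuous (f j)) -> closed [set y | all (fun j => 0 <= f j y) A]%classic.
Proof.
move=> cf; elim: A => [|j A IHA] /=.
  by rewrite (_ : mkset _ = setT); [apply: closedT | apply/seteqP; split].
rewrite (_ : mkset _ = (f j @^-1` [set x | 0 <= x] `&`
    [set y | all (fun j => 0 <= f j y) A])%classic); last first.
  by apply/seteqP; split=> y /=; [move/andP|move=> [? ?]; apply/andP].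
apply: closedI => //; apply: preimage_closed; last exact: closed_ge.
by move=> y _; apply: cf.
Qed.

Lemma exists_small_factor (X : eqType) (N : seq X) (a b : X -> R) :
  {in N, forall x, 0 < b x} ->
  exists2 eps, 0 < eps & {in N, forall x, eps * a x < b x}.
Proof.
elim: N => [|x N IHN] bN; first by exists 1.
have [|eps eps0 epsN] := IHN; first by move=> y yN; apply: bN; rewrite inE yN orbT.
have bx : 0 < b x by apply: bN; rewrite mem_head.
pose del := Num.min eps (b x / (`|a x| + 1)).
have a1 : 0 < `|a x| + 1 by rewrite ltr_wpDl.
have del0 : 0 < del by rewrite lt_min eps0 divr_gt0.
have delx : del * (`|a x| + 1) <= b x.
  by rewrite -ler_pdivlMr // ge_min lexx orbT.
exists del => // y; rewrite inE => /predU1P[->|yN].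
  apply: lt_le_trans delx; rewrite ltr_pM2l //.
  by apply: le_lt_trans (ler_norm _) _; rewrite ltrDl.
have [ay|ay] := leP 0 (a y).
  by apply: le_lt_trans (epsN y yN); rewrite ler_wpM2r // ge_min lexx.
apply: lt_trans (_ : 0 < _); first by rewrite pmulr_rlt0.
by apply: bN; rewrite inE yN orbT.
Qed.

(** Minimise [H = eps * \sum_i y_i ^ D - G] over the closed sign class of [x] inside the box. The
    minimum is negative because [H x] is. Hence [G] is positive at the minimiser and no [phi j]
    vanishes there; as [H] is nonnegative on the faces of the box, the minimiser is interior.
    Stationarity in each coordinate gives the equations. *)
Lemma sign_class_critical (J : Type) (A : seq J) (phi : J -> pt -> R) k (eps rho : R)
    (G : pt -> R) (e : nat) (g : 'I_n -> pt -> R) (x : pt) :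
    let D := e.+2 in
    (forall j, poly_fun k (phi j)) -> poly_fun e G -> ~~ odd e ->
    (forall y, 0 < G y -> all (fun j => phi j y != 0) A) ->
    (forall i y, exists2 C, 0 <= C & forall t, `|t| <= 1 ->
      `|G (y + t *: dir i) - G y - t * g i y| <= C * t ^+ 2) ->
    0 < eps -> 0 < rho ->
    (forall (y : pt) i, (forall j, `|y 0 j| <= rho) -> `|y 0 i| = rho ->
       G y <= eps * \sum_i y 0 i ^+ D) ->
    (forall i, `|x 0 i| <= rho) -> eps * \sum_i x 0 i ^+ D < G x ->
  exists y : pt, all (fun j => 0 < phi j x * phi j y) A /\
    forall i, y 0 i ^+ e.+1 = (eps * D%:R)^-1 * g i y.
Proof.
move=> D pphi pG ev Gall gC eps0 rho0 bdry xbox Hx.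
pose H (y : pt) := eps * (\sum_i y 0 i ^+ D) - G y.
(* Sign conditions and box constraints form one family, so that closedness and stability under small
   moves are shown once. *)
pose f (c : J + 'I_n) (y : pt) :=
  match c with inl j => phi j x * phi j y | inr i => rho ^+ 2 - y 0 i ^+ 2 end.
pose cs := [seq inl j | j <- A] ++ [seq inr i | i <- index_enum 'I_n].
have pfc c : exists d, poly_fun d (f c).
  case: c => [j|i] /=; first by exists k; apply: poly_funZ.
  exists (2 * 1)%N; apply: poly_fun_ext (poly_funD (poly_fun_const n _ (rho ^+ 2))
    (poly_funZ (-1) (poly_fun_exp 2 (poly_funX R i)))) => y /=.
  by rewrite mulN1r.
have csE (P : J + 'I_n -> bool) : all P cs =
    all (P \o inl) A && [forall i, P (inr i)].
  rewrite all_cat !all_map; congr (_ && _).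
  apply/allP/forallP => [h i|h i _]; last exact: h.
  by apply: (h i); rewrite mem_index_enum.
have ev2 : ~~ odd D by rewrite /= negbK.
have S0 y : 0 <= \sum_i (y : pt) 0 i ^+ D.
  by apply: sumr_ge0 => i _; apply: exprn_even_ge0.
have sqb (a : R) : (0 <= rho ^+ 2 - a ^+ 2) = (`|a| <= rho).
  rewrite subr_ge0 -[a ^+ 2]real_normK ?num_real //.
  by rewrite ler_pXn2r // nnegrE ?ltW.
have sqb' (a : R) : (0 < rho ^+ 2 - a ^+ 2) = (`|a| < rho).
  rewrite subr_gt0 -[a ^+ 2]real_normK ?num_real //.
  by rewrite ltr_pXn2r // nnegrE ?ltW.
pose Z := [set y | all (fun c => 0 <= f c y) cs]%classic.
have cZ : compact Z.
  apply: (@subclosed_compact _ _ [set v : pt | forall i, `[- rho, rho]%classic (v ord0 i)]%classic).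
  - by apply: closed_nonneg => c; have [d /poly_fun_continuous] := pfc c.
  - apply: (@rV_compact R n (fun=> `[- rho, rho]%classic)) => i.
    exact: segment_compact.
  - move=> y; rewrite /Z /= csE => /andP[_ /forallP b] i; have := b i.
    by rewrite /= sqb in_itv /= ler_norml.
have Gx : 0 < G x by apply: le_lt_trans Hx; rewrite mulr_ge0 // ltW.
have Zx : Z x.
  rewrite /Z /= csE; apply/andP; split.
    by apply/allT => j /=; rewrite -expr2 sqr_ge0.
  by apply/forallP => i /=; rewrite sqb.
have cH : continuous H.
  have pH : poly_fun (maxn (D * 1) e) H.
    apply: poly_fun_ext (_ : poly_fun _ (fun y => eps * (\sum_i y 0 i ^+ D) + (-1) * G y)).
      by move=> y; rewrite mulN1r.
    apply: poly_funD; last by apply: poly_fun_le (leq_maxr _ _) (poly_funZ _ pG).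
    apply: poly_fun_le (leq_maxl _ _) (poly_funZ _ _).
    by apply: poly_fun_sum => i; apply/poly_fun_exp/poly_funX.
  exact: poly_fun_continuous pH.
have [||y /set_mem Zy ymin] := @EVT_min_rV _ _ H Z _ cZ.
- by exists x.
- exact: continuous_subspaceT.
have Hy : H y < 0.
  apply: le_lt_trans (ymin x (mem_set Zx)) _.
  by rewrite /H subr_lt0.
have Gy : 0 < G y.
  by move: Hy; rewrite /H subr_lt0; apply: le_lt_trans; rewrite mulr_ge0 // ltW.
move: (Zy); rewrite /Z /= csE => /andP[Zphi /forallP Zbox].
have ybox i : `|y 0 i| <= rho by have := Zbox i; rewrite /= sqb.
have ypos : all (fun c => 0 < f c y) cs.
  rewrite csE; apply/andP; split.
    have := Gall _ Gx; have := Gall _ Gy; move: Zphi.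
    elim: (A) => //= j B IHB /andP[j0 /IHB{}IHB] /andP[jy /IHB{}IHB] /andP[jx /IHB->].
    by rewrite andbT lt_neqAle j0 eq_sym mulf_neq0.
  apply/forallP => i /=; rewrite sqb' lt_neqAle ybox andbT.
  apply/eqP => yi; have := bdry y i ybox yi.
  by move: Hy; rewrite /H subr_lt0 => /lt_le_trans h /h; rewrite ltxx.
exists y; split; first by move: ypos; rewrite csE => /andP[].
move=> i; have [tau tau0 pos] := poly_funs_stay_pos i pfc ypos.
have [C C0 GC] := gC i y.
have [C' C0' XC] := exprD_taylor (y 0 i) D.
have eD : eps * D%:R != 0 by rewrite mulf_neq0 ?gt_eqF // ltr0n.
suff s0 : eps * (D%:R * y 0 i ^+ e.+1) - g i y = 0.
  move/eqP: s0; rewrite subr_eq0 mulrA => /eqP <-.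
  by rewrite mulKf.
apply: (@local_min_slope0 _ (eps * C' + C) tau) => //.
  by rewrite addr_ge0 // mulr_ge0 // ltW.
move=> t tt t1.
have Zt : Z (y + t *: dir i).
  by apply: sub_all (pos t tt) => c; apply: ltW.
have := ymin _ (mem_set Zt); rewrite -subr_ge0 => le_H.
have sumE : \sum_j (y + t *: dir i) 0 j ^+ D =
    \sum_j y 0 j ^+ D + ((y 0 i + t) ^+ D - y 0 i ^+ D).
  rewrite (bigD1 i) //= [in RHS](bigD1 i) //= !mxE !eqxx mulr1.
  rewrite (eq_bigr (fun j => y 0 j ^+ D)); first by ring.
  by move=> j /negbTE ji; rewrite !mxE ji andbF mulr0 addr0.
move: le_H (GC t t1) (XC t t1); rewrite /H sumE /= !ler_norml.
move=> le_H /andP[lo _] /andP[_ hi].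
have {hi} : eps * ((y 0 i + t) ^+ D - y 0 i ^+ D - t * (D%:R * y 0 i ^+ e.+1))
    <= eps * (C' * t ^+ 2) by rewrite ler_pM2l.
move: le_H lo; move: ((y 0 i + t) ^+ D) (y 0 i ^+ D) (\sum_j _) => u v w.
by move: (G (_ + _)) (G y) (g i y) (D%:R * _) => a b c d'; nra.
Qed.

(* Warren's bound.  With [G] the product of the squares, the function
   [eps * \sum_i x_i ^+ D - G] has a negative minimum in every sign class, and
   its critical points are counted by reduction modulo
   [x_i ^+ D.-1 = lower degree]. *)
Lemma sign_patterns_le (J : eqType) (A : seq J) (phi : J -> pt -> R) k (N : seq pt) :
    (forall j, poly_fun k (phi j)) ->
    {in N, forall x, all (fun j => phi j x != 0) A} ->
    uniq [seq pattern (fun x j => 0 < phi j x) A x | x <- N] ->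
  (size N <= (size A * (2 * k)).+1 ^ n)%N.
Proof.
move=> pphi nz uN.
pose G (y : pt) := \prod_(j <- A) phi j y ^+ 2.
(* [D] is the least even number above the degree bound [e] of [G]. Evenness keeps [\sum_i x_i ^ D]
   nonnegative, and [D.-1] exceeds the degree of the partial derivatives of [G]. *)
set e := (size A * (2 * k))%N; pose D := e.+2.
have pG : poly_fun e G by apply: poly_fun_prod => j; apply: poly_fun_exp.
have ev : ~~ odd e by rewrite /e oddM oddM andbF.
have ev2 : ~~ odd D by rewrite /= negbK.
have Gall y : 0 < G y -> all (fun j => phi j y != 0) A.
  rewrite /G; elim: (A) => //= j B IHB; rewrite big_cons => GB.
  have [pj|pj] := eqVneq (phi j y) 0; first by rewrite pj expr0n mul0r ltxx in GB.
  by apply: IHB; rewrite pmulr_rgt0 // exprn_even_gt0 in GB.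
have Gpos : {in N, forall x, 0 < G x}.
  move=> x /nz; rewrite /G; elim: (A) => [|j B IHB] /=; first by rewrite big_nil.
  by move=> /andP[pj /IHB]; rewrite big_cons; apply: mulr_gt0; rewrite exprn_even_gt0.
have [eps eps0 epsN] := @exists_small_factor _ N (fun x => \sum_i x 0 i ^+ D) G Gpos.
have [C C0 GC] := poly_fun_growth pG.
(* The growth bound wants [1 <= rho], the faces want [C <= eps * rho], whence
   [C * rho ^ e <= eps * rho ^ D], and the sum puts all of [N] into the box. *)
pose rho := 1 + C / eps + \sum_(x <- N) \sum_i `|x 0 i|.
have s0 : 0 <= \sum_(x <- N) \sum_i `|x 0 i|.
  by apply: sumr_ge0 => x _; apply: sumr_ge0.
have Ce : 0 <= C / eps by rewrite divr_ge0 // ltW.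
have rho1 : 1 <= rho by rewrite /rho; lra.
have xbox x i : x \in N -> `|x 0 i| <= rho.
  move=> xN; rewrite /rho (big_rem x) //= (bigD1 i) //=.
  have : 0 <= \sum_(y <- rem x N) \sum_i `|y 0 i|.
    by apply: sumr_ge0 => y _; apply: sumr_ge0.
  have : 0 <= \sum_(j < n | j != i) `|x 0 j| by apply: sumr_ge0.
  by lra.
have bdry (y : pt) i : (forall j, `|y 0 j| <= rho) -> `|y 0 i| = rho ->
    G y <= eps * \sum_i y 0 i ^+ D.
  move=> ybox yi; apply: le_trans (ler_norm _) _.
  apply: le_trans (GC y rho rho1 ybox) _.
  apply: le_trans (_ : eps * y 0 i ^+ D <= _); last first.
    rewrite ler_pM2l // (bigD1 i) //= lerDl; apply: sumr_ge0 => j _.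
    exact: exprn_even_ge0.
  have -> : y 0 i ^+ D = rho ^+ D.
    rewrite -yi -normrX ger0_norm //; exact: exprn_even_ge0.
  rewrite /D !exprS mulrA mulrA [leRHS]mulrC [leLHS]mulrC.
  rewrite ler_pM2l ?exprn_gt0 ?(lt_le_trans ltr01) //.
  have : C / eps <= rho by rewrite /rho; lra.
  rewrite ler_pdivrMr // => Cr; apply: le_trans Cr _.
  rewrite mulrC ler_peMr // mulr_ge0 ?ltW //; lra.
have [g gP] := choice (fun i => poly_fun_deriv i pG).
have crit x : exists y : pt, x \in N -> all (fun j => 0 < phi j x * phi j y) A /\
    forall i, y 0 i ^+ e.+1 = (eps * D%:R)^-1 * g i y.
  have [xN|_] := boolP (x \in N); last by exists x.
  have rho0 : 0 < rho by lra.
  have gC i (y : pt) := let: And3 _ _ h := gP i in h y.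
  have [y Hy] := sign_class_critical pphi pG ev Gall gC eps0 rho0 bdry
    (fun i => xbox x i xN) (epsN x xN).
  by exists y.
have [Y YP] := choice crit.
have patE x : x \in N -> pattern (fun x j => 0 < phi j x) A (Y x) =
    pattern (fun x j => 0 < phi j x) A x.
  move=> xN; have [] := YP x xN; rewrite /pattern => + _.
  elim: (A) => //= j B IHB /andP[jpos /IHB->]; congr (_ :: _).
  move: jpos; have [p0|p0|<-] := ltgtP 0 (phi j x); last by rewrite mul0r ltxx.
    by rewrite pmulr_rgt0 // => ->.
  by rewrite nmulr_rgt0 // => h; apply/negbTE; rewrite -leNgt ltW.
(* A critical point has the sign pattern of its [x], so distinct patterns give distinct critical
   points. *)
have uY : uniq [seq Y x | x <- N].
  apply: (@map_uniq _ _ (pattern (fun x j => 0 < phi j x) A)).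
  rewrite -map_comp (_ : [seq _ | x <- N] =
    [seq pattern (fun x j => 0 < phi j x) A x | x <- N]) //.
  by apply/eq_in_map => x /patE.
rewrite -(size_map Y).
apply: (@common_zeros_le R n e.+1 [seq Y x | x <- N]
  (fun i y => (eps * D%:R)^-1 * g i y)) => //.
  move=> i; apply: poly_funZ => /=; have [pg _ _] := gP i.
  exact: poly_fun_le (leq_pred e) pg.
by move=> i z /mapP[x /YP[_ xP] ->]; apply: xP.
Qed.

End SignPatterns.

(** * Covering points by few balls *)

Local Open Scope nat_scope.

Section Representatives.
Variables (X J : eqType) (sgn : X -> J -> bool).
Local Notation pattern := (pattern sgn).

Lemma class_count_reps N A : exists N' : seq X,
  [/\ {subset N' <= N}, size N' = class_count sgn N A &
      uniq [seq pattern A x | x <- N']].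
Proof.
elim: A N => [|i A IHA] N.
  case: N => [|x N].
    by exists [::]; split.
  by exists [:: x]; split=> // y; rewrite !inE => /eqP->; rewrite eqxx.
have [N0 [sub0 size0 uniq0]] := IHA [seq x <- N | sgn x i == false].
have [N1 [sub1 size1 uniq1]] := IHA [seq x <- N | sgn x i == true].
have h0 x : x \in N0 -> sgn x i = false /\ x \in N.
  by move/sub0; rewrite mem_filter => /andP[/eqP->].
have h1 x : x \in N1 -> sgn x i = true /\ x \in N.
  by move/sub1; rewrite mem_filter => /andP[/eqP->].
exists (N0 ++ N1); split.
- by move=> x; rewrite mem_cat => /orP[/h0[]|/h1[]].
- by rewrite size_cat class_count_cons size0 size1.
rewrite map_cat cat_uniq.
have consE b (M : seq X) : (forall x, x \in M -> sgn x i = b) ->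
    [seq pattern (i :: A) x | x <- M] = [seq b :: v | v <- [seq pattern A x | x <- M]].
  by move=> Mb; rewrite -map_comp; apply/eq_in_map => x /Mb /= ->.
rewrite (consE false) => [|x /h0[] //]; rewrite (consE true) => [|x /h1[] //].
have cons_inj b : injective (cons b : seq bool -> seq bool) by move=> u v [].
rewrite !(map_inj_uniq (cons_inj _)) uniq0 uniq1 andbT /=.
by apply/hasPn => _ /mapP[v _ ->]; apply/mapP => -[].
Qed.

(** Turns positions in the cube back into indices, so that the bound on sign patterns can be
    confronted with [2 ^ d] points. *)
Lemma shatters_reps d N A : shatters d (size A) (class_size sgn N A) ->
  exists (A' : seq J) (N' : seq X), [/\ size A' = d, {subset A' <= A},
    {subset N' <= N}, size N' = 2 ^ d & uniq [seq pattern A' x | x <- N']].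
Proof.
move=> [P sP sh].
have in_range j : j \in P -> j < size A.
  have [v [sv _ e]] := sh (nseq d true) (size_nseq _ _).
  move=> jP; rewrite -sv ltnNge; apply/negP => /(nth_default false) vj.
  have : nth false v j \in nseq d true by rewrite -e; apply: map_f.
  by rewrite vj mem_nseq andbF.
have [/hasP[j0 _ _]|A0] := boolP (has predT A).
  pose A' := [seq nth j0 A j | j <- P].
  have reps (u : d.-tuple bool) : exists x, x \in N /\ pattern A' x = u.
    have [v [sv]] := sh u (size_tuple u).
    rewrite /class_size -has_count => /hasP[x xN /eqP xv] e.
    exists x; split=> //; rewrite -e -xv /pattern -!map_comp.
    by apply/eq_in_map => j /in_range jA /=; rewrite (nth_map j0).
  have [f fP] := choice reps.
  exists A', [seq f u | u : d.-tuple bool]; split.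
  - by rewrite size_map.
  - by move=> _ /mapP[j /in_range jA ->]; apply: mem_nth.
  - by move=> _ /codomP[u ->]; have [] := fP u.
  - by rewrite size_codom card_tuple card_bool.
  - rewrite -map_comp (_ : [seq _ | u <- _] = [seq val u | u <- enum {: d.-tuple bool}]).
      by rewrite (map_inj_uniq val_inj) enum_uniq.
    by apply/eq_map => u /=; have [_ ->] := fP u.
have P0 : P = [::].
  case: (P) in_range => // j P' /(_ j (mem_head _ _)).
  by case: (A) A0.
have d0 : d = 0 by rewrite -sP P0.
have [v [sv]] := sh [::] (esym d0); rewrite /class_size -has_count.
move=> /hasP[x xN _] _; exists [::], [:: x]; split; rewrite ?d0 //.
by move=> y; rewrite inE => /eqP->.
Qed.
End Representatives.

Section Cover.
Local Open Scope ring_scope.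

Lemma sign_cover : exists C : nat, forall (R : realType) (J : eqType) (I : seq J)
    (phi : J -> 'rV[R]_3 -> R) (N : seq 'rV[R]_3) (r : nat), (0 < r)%N ->
    (forall j, poly_fun 2 (phi j)) ->
    {in N, forall x, all (fun j => phi j x != 0) I} ->
  exists Z : seq 'rV[R]_3, [/\ {subset Z <= N}, (size Z <= C * r ^ 3)%N &
    forall x, x \in N -> exists2 c, c \in Z &
      (r * separation I (fun x j => 0 < phi j x)%R x c <= size I)%N].
Proof.
(* Samples have [4 * 19 * r - 1] quadrics, which have at most [(4 * (76 * r - 1) + 1) ^ 3 <= (304 *
   r) ^ 3] sign patterns. *)
have [q qE] : exists q, q = 304%N by exists 304%N.
exists (2 * q ^ 3)%N => R J I phi N r r0 pphi nz.
set sgn := fun x j => 0 < phi j x.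
have [I0|I0] := posnP (size I).
  case: N nz => [|x N] nz; first by exists [::]; split.
  exists [:: x]; split=> [y||y yN].
  - by rewrite inE => /eqP->; rewrite mem_head.
  - by rewrite /= muln_gt0 muln_gt0 !expn_gt0 r0 qE.
  - by exists x; rewrite ?mem_head // (size0nil I0) /separation muln0.
have [Z [uZ ZN sepZ cov]] := maximal_separated I sgn r N.
exists Z; split=> //.
have nzZ (A : seq J) (M : seq 'rV[R]_3) : {subset A <= I} -> {subset M <= Z} ->
    {in M, forall x, all (fun j => phi j x != 0) A}.
  move=> AI MZ x /MZ /ZN /nz /allP nzx; apply/allP => j /AI; exact: nzx.
have sE : (4 * 19 * r).-1.+1 = (4 * 19 * r)%N by rewrite prednK // muln_gt0.
(* No 20 quadrics are shattered, since [81 ^ 3 < 2 ^ 20]. *)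
apply: leq_trans (@packing_bound _ _ I sgn r 19 _ ((q * r) ^ 3)%N Z I0 _ uZ sepZ sE _ _) _ => //.
- move=> A AI /shatters_reps[A' [N' [sA' A'A N'Z sN' uN']]].
  have := sign_patterns_le pphi (nzZ A' N' (fun j h => AI j (A'A j h)) N'Z) uN'.
  rewrite sA' sN' (expnD 2 10 10).
  have -> : (2 ^ 10 = 1024)%N by [].
  have -> : (20 * (2 * 2)).+1 = 81%N by [].
  by rewrite !expnS expn0; lia.
- move=> A sA AI; have [N' [N'Z sN' uN']] := class_count_reps sgn Z A.
  rewrite -sN'; apply: leq_trans (sign_patterns_le pphi (nzZ A N' AI N'Z) uN') _.
  rewrite sA leq_exp2r //; move: sE; move: (4 * 19 * r)%N.-1 => s; lia.
- by rewrite expnMn mulnA.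
Qed.

(* Each [b] sorts the points into levels by [g b]; the values in [V b] separate
   [p] from its centre [c] at most [1 / r] of the time. *)
Lemma level_cover : exists C : nat, forall (R : realType) (B : eqType) (bs : seq B)
    (V : B -> seq R) (g : B -> 'rV[R]_3 -> R) (N : seq 'rV[R]_3) (r : nat),
    (0 < r)%N ->
    (forall b th, b \in bs -> exists2 f, poly_fun 2 f &
      {in N, forall p, (0 < f p) = (th < g b p) /\ (f p == 0) = (g b p == th)}) ->
  exists Z : seq 'rV[R]_3, [/\ {subset Z <= N}, (size Z <= C * r ^ 3)%N &
    forall p, p \in N -> exists2 c, c \in Z &
      (r * \sum_(b <- bs) count (fun v => (v <= g b p)%R != (v <= g b c)%R) (V b)
       <= \sum_(b <- bs) size (V b))%N].
Proof.
have [C coverC] := sign_cover; exists C => R B bs V g N r r0 pg.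
pose I := [seq (b, v) | b <- bs, v <- V b].
pose gaps := [seq (bv, p) | bv <- I, p <- N].
(* A value [v] may be attained, and a test at [v] would then vanish at a point. Only finitely many
   gaps occur, so [v] can be lowered by [eps] without changing the truth of [v <= g b p]. *)
have [eps eps0 epsP] : exists2 eps : R, 0 < eps &
    forall b v p, (b, v) \in I -> p \in N -> g b p < v -> g b p < v - eps.
  have [|eps eps0 epsP] := @exists_small_factor R _
    [seq w <- gaps | g w.1.1 w.2 < w.1.2] (fun=> 1) (fun w => w.1.2 - g w.1.1 w.2).
    by move=> w; rewrite mem_filter subr_gt0 => /andP[].
  exists eps => // b v p bI pN gv.
  have := epsP ((b, v), p); rewrite mem_filter gv allpairs_f //= mulr1 => /(_ isT).
  by lra.
have thresholds (j : B * R) : exists f : 'rV[R]_3 -> R, poly_fun 2 f /\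
    (j.1 \in bs -> {in N, forall p, (0 < f p) = (j.2 - eps < g j.1 p) /\
      (f p == 0) = (g j.1 p == j.2 - eps)}).
  case: j => b v /=; have [bb|_] := boolP (b \in bs).
    by have [f pf fP] := pg b (v - eps) bb; exists f.
  by exists (fun=> 0); split=> //; apply: poly_fun_const.
have [phi phiP] := choice thresholds.
have Ibs j : j \in I -> j.1 \in bs.
  by move=> /allpairsPdep[b [v [bb _ ->]]].
have sgnE j p : j \in I -> p \in N -> (0 < phi j p) = (j.2 <= g j.1 p) /\ phi j p != 0.
  case: j => b v bI pN; have [_ /(_ (Ibs _ bI) p pN)[-> ->]] := phiP (b, v).
  rewrite /=; have [vg|gv] := leP v (g b p).
    by split; [lra|apply/eqP => e; lra].
  by have := epsP b v p bI pN gv; split; [lra|apply/eqP => e; lra].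
have [|Z [ZN sZ cov]] := coverC R _ I phi N r r0 (fun j => (phiP j).1).
  by move=> p pN; apply/allP => j jI; have [] := sgnE j p jI pN.
exists Z; split=> // p pN; have [c cZ le_c] := cov p pN; exists c => //.
have sizeE : size I = (\sum_(b <- bs) size (V b))%N.
  by rewrite /I size_allpairs_dep sumnE big_map.
rewrite -sizeE; apply: leq_trans le_c; rewrite leq_mul2l; apply/orP; right.
rewrite /separation /I; apply: eq_leq.
rewrite (eq_in_count (a2 := fun j => (j.2 <= g j.1 p) != (j.2 <= g j.1 c))); last first.
  move=> j jI; have [-> _] := sgnE j p jI pN.
  by have [-> _] := sgnE j c jI (ZN _ cZ).
rewrite count_flatten -map_comp sumnE big_map; apply: eq_bigr => b _ /=.
by rewrite count_map; apply: eq_count.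
Qed.

End Cover.

(** * Cylinders with axes through the origin *)

Local Open Scope ring_scope.

Section Vectors.
Variable R : realType.
Local Notation pt := 'rV[R]_3.
Implicit Types (u v w p q r : pt).

Definition dot u v : R := \sum_i u 0 i * v 0 i.

Lemma sum3E (F : 'I_3 -> R) : \sum_i F i = F 0 + F 1 + F 2%:R.
Proof.
rewrite !big_ord_recl big_ord0 addr0 addrA; congr (F _ + F _ + F _);
  exact/val_inj.
Qed.

Lemma dotE u v : dot u v = u 0 0 * v 0 0 + u 0 1 * v 0 1 + u 0 2%:R * v 0 2%:R.
Proof. exact: sum3E. Qed.

Lemma cross0E u v : cross_product u v 0 0 = u 0 1 * v 0 2%:R - u 0 2%:R * v 0 1.
Proof. by rewrite mxE !add0r. Qed.

Lemma cross1E u v : cross_product u v 0 1 = u 0 2%:R * v 0 0 - u 0 0 * v 0 2%:R.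
Proof.
rewrite mxE; have -> : (1 + 1 : 'I_3) = 2%:R by [].
by have -> : (1 + 2%:R : 'I_3) = 0 by apply/val_inj.
Qed.

Lemma cross2E u v : cross_product u v 0 2%:R = u 0 0 * v 0 1 - u 0 1 * v 0 0.
Proof.
rewrite mxE; have -> : (2%:R + 1 : 'I_3) = 0 by apply/val_inj.
by have -> : (2%:R + 2%:R : 'I_3) = 1 by apply/val_inj.
Qed.

Lemma coord_zero i : (0 : pt) 0 i = 0. Proof. by rewrite mxE. Qed.
Lemma coord_add u v i : (u + v) 0 i = u 0 i + v 0 i. Proof. by rewrite mxE. Qed.
Lemma coord_opp u i : (- u) 0 i = - u 0 i. Proof. by rewrite mxE. Qed.
Lemma coord_scale k u i : (k *: u) 0 i = k * u 0 i. Proof. by rewrite mxE. Qed.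

Definition crossE := (cross0E, cross1E, cross2E).
Definition coordE := (coord_zero, coord_add, coord_opp, coord_scale, crossE).

Lemma row3P u v : [/\ u 0 0 = v 0 0, u 0 1 = v 0 1 & u 0 2%:R = v 0 2%:R] -> u = v.
Proof.
move=> [e0 e1 e2]; apply/rowP => -[[|[|[|//]]] i3].
- by rewrite (_ : Ordinal i3 = 0) //; apply/val_inj.
- by rewrite (_ : Ordinal i3 = 1) //; apply/val_inj.
- by rewrite (_ : Ordinal i3 = 2%:R) //; apply/val_inj.
Qed.

Lemma dot_ge0 u : 0 <= dot u u.
Proof. by apply: sumr_ge0 => i _; rewrite -expr2 sqr_ge0. Qed.

Lemma dot_eq0 u : (dot u u == 0) = (u == 0).
Proof.
apply/eqP/eqP => [/eqP|->]; last by rewrite /dot big1 // => i _; rewrite mxE mul0r.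
rewrite psumr_eq0 => [/allP u0|i _]; last by rewrite -expr2 sqr_ge0.
apply/rowP => i; rewrite mxE; apply/eqP.
by have := u0 i (mem_index_enum i); rewrite mulf_eq0 orbb.
Qed.

Lemma lagrange_identity u v :
  dot (cross_product u v) (cross_product u v) =
  dot u u * dot v v - dot u v ^+ 2.
Proof. by rewrite !dotE !crossE; ring. Qed.

Lemma crossC u v : cross_product v u = - cross_product u v.
Proof. by apply: row3P; rewrite !coordE; split; ring. Qed.

Lemma double_cross u v :
  cross_product u (cross_product u v) = dot u v *: u - dot u u *: v.
Proof. by apply: row3P; rewrite !dotE !coordE; split; ring. Qed.

Lemma cross_eq0P u v : u != 0 ->
  reflect (exists k, v = k *: u) (cross_product u v == 0).
Proof.
move=> u0; apply: (iffP eqP) => [e|[k ->]]; last first.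
  by apply: row3P; rewrite !coordE; split; ring.
have d0 : dot u u != 0 by rewrite dot_eq0.
exists (dot u v / dot u u); apply: (scalerI d0).
rewrite scalerA mulrCA divff // mulr1; apply/esym/eqP; rewrite -subr_eq0.
rewrite -double_cross e; apply/eqP; apply: row3P.
by rewrite !coordE; split; ring.
Qed.

Lemma cross_trans0 u p q : u != 0 ->
  cross_product u p = 0 -> cross_product u q = 0 -> cross_product p q = 0.
Proof.
move=> u0 /eqP/(cross_eq0P _ u0)[k ->] /eqP/(cross_eq0P _ u0)[l ->].
by apply: row3P; rewrite !coordE; split; ring.
Qed.

Definition det3 p q r : R := dot (cross_product p q) r.

(** The three cross products are, up to the factor [det3 p q r], the dual basis of [p], [q], [r]. *)
Lemma cramer3 p q r u : det3 p q r *: u =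
  dot p u *: cross_product q r + dot q u *: cross_product r p
  + dot r u *: cross_product p q.
Proof.
by apply: row3P; rewrite /det3 !dotE !coordE; split; ring.
Qed.

End Vectors.

(** * Axes of the cylinders through three given points *)

Section ThreeCylinders.
Variable R : realType.
Local Notation pt := 'rV[R]_3.
Implicit Types (u v p q r : pt).
Local Notation "u '\x' v" := (cross_product u v) (at level 40).

Lemma size_polyM_leq (a b : {poly R}) d e :
  (size a <= d.+1)%N -> (size b <= e.+1)%N -> (size (a * b)%R <= (d + e).+1)%N.
Proof. by move=> sa sb; apply: leq_trans (size_polyMleq _ _) _; lia. Qed.

Lemma size_polyD_leq (a b : {poly R}) d :
  (size a <= d)%N -> (size b <= d)%N -> (size (a + b)%R <= d)%N.
Proof. by move=> sa sb; apply: leq_trans (size_polyD _ _) _; rewrite geq_max sa. Qed.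

Lemma size_polyC_leqS (c : R) d : (size (c%:P)%R <= d.+1)%N.
Proof. by apply: leq_trans (size_polyC_leq1 _) _. Qed.

(** For a unit vector [u] let [x], [y], [z] be its inner products with [p], [q], [r]. Squared
    distance [w] from the axis means [x ^ 2 = P - w], where [P = dot p p], and likewise for [q] and
    [r]. The squared norm of the expansion in [cramer3] then reads [s = X + Y + Z] with
    [X = 2 * g12 * (x * y)] and so on; [gij] is the Gram matrix of the three cross products, [k] is
    [det3 p q r ^ 2], and ['X] stands for [w]. The product of the four conjugates of [s - X - Y - Z]
    under sign changes of [x], [y], [z] involves only their squares, hence is a polynomial in
    [w]. *)
Definition cylinder_eliminant (P Q S k g11 g22 g33 g12 g13 g23 : R) : {poly R} :=
  let A := P%:P - 'X in let B := Q%:P - 'X in let C := S%:P - 'X in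
  let s := k%:P - g11%:P * A - g22%:P * B - g33%:P * C in
  let X2 := (4 * g12 ^+ 2)%:P * (A * B) in
  let Y2 := (4 * g13 ^+ 2)%:P * (A * C) in
  let Z2 := (4 * g23 ^+ 2)%:P * (B * C) in
  s * s * (s * s) + X2 * X2 + Y2 * Y2 + Z2 * Z2
  - 2%:P * (s * s * (X2 + Y2 + Z2) + X2 * Y2 + X2 * Z2 + Y2 * Z2)
  - (64 * (g12 * g13 * g23))%:P * (s * (A * (B * C))).

Lemma size_cylinder_eliminant P Q S k g11 g22 g33 g12 g13 g23 :
  (size (cylinder_eliminant P Q S k g11 g22 g33 g12 g13 g23) <= 5)%N.
Proof.
rewrite /cylinder_eliminant.
have sXC c : (size (c%:P - 'X : {poly R})%R <= 2)%N.
  by rewrite -opprB size_polyN size_XsubC.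
have sN (a : {poly R}) d : (size a <= d)%N -> (size (- a)%R <= d)%N by rewrite size_polyN.
have sCM c (a : {poly R}) d : (size a <= d.+1)%N -> (size (c%:P * a)%R <= d.+1)%N.
  by move=> sa; apply: (@size_polyM_leq _ _ 0 d); rewrite ?size_polyC_leqS.
set A := P%:P - 'X; set B := Q%:P - 'X; set C := S%:P - 'X.
have sA := sXC P; have sB := sXC Q; have sC := sXC S; rewrite -/A -/B -/C in sA sB sC.
set s := _ - _ - _ - _.
have ss : (size s <= 2)%N.
  by rewrite !size_polyD_leq ?sN ?sCM ?size_polyC_leqS.
have s2 : (size (s * s)%R <= 3)%N by apply: (@size_polyM_leq _ _ 1 1).
have sM (a b : {poly R}) : (size a <= 3)%N -> (size b <= 3)%N -> (size (a * b)%R <= 5)%N.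
  exact: (@size_polyM_leq _ _ 2 2).
set X2 := _ * (A * B); set Y2 := _ * (A * C); set Z2 := _ * (B * C).
have sX : (size X2 <= 3)%N by apply/sCM/(@size_polyM_leq _ _ 1 1).
have sY : (size Y2 <= 3)%N by apply/sCM/(@size_polyM_leq _ _ 1 1).
have sZ : (size Z2 <= 3)%N by apply/sCM/(@size_polyM_leq _ _ 1 1).
apply: size_polyD_leq; last first.
  apply/sN/sCM/(@size_polyM_leq _ _ 1 3) => //; apply: (@size_polyM_leq _ _ 1 2) => //.
  exact: (@size_polyM_leq _ _ 1 1).
apply: size_polyD_leq; last first.
  apply/sN/sCM; do !apply: size_polyD_leq; apply: sM => //.
  by do !apply: size_polyD_leq.
by do !apply: size_polyD_leq; apply: sM.
Qed.

Lemma cylinder_eliminant_factor (P Q S k g11 g22 g33 g12 g13 g23 w x y z : R) :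
    P - w = x ^+ 2 -> Q - w = y ^+ 2 -> S - w = z ^+ 2 ->
  let s := k - g11 * x ^+ 2 - g22 * y ^+ 2 - g33 * z ^+ 2 in
  let X := 2 * g12 * (x * y) in let Y := 2 * g13 * (x * z) in
  let Z := 2 * g23 * (y * z) in
  (cylinder_eliminant P Q S k g11 g22 g33 g12 g13 g23).[w] =
  (s - X - Y - Z) * (s - X + Y + Z) * (s + X - Y + Z) * (s + X + Y - Z).
Proof.
move=> eP eQ eS; rewrite /cylinder_eliminant.
have hXC c : (c%:P - 'X).[w] = c - w by rewrite hornerD hornerC hornerN hornerX.
have := (hXC P, hXC Q, hXC S); rewrite eP eQ eS /=.
move: (P%:P - 'X) (Q%:P - 'X) (S%:P - 'X) => A B C [[hA hB] hC].
have : (k%:P - g11%:P * A - g22%:P * B - g33%:P * C).[w] =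
    k - g11 * x ^+ 2 - g22 * y ^+ 2 - g33 * z ^+ 2.
  by rewrite !(hornerD, hornerN, hornerM, hornerC) hA hB hC.
move: (k%:P - _ - _ - _) (k - _ - _ - _) => s s' hs.
rewrite !(hornerD, hornerN, hornerM, hornerC) hA hB hC hs; ring.
Qed.

Lemma dot_sum3 (a b c : R) (u v w : pt) :
  let U := a *: u + b *: v + c *: w in
  dot U U = dot u u * a ^+ 2 + dot v v * b ^+ 2 + dot w w * c ^+ 2
    + 2 * dot u v * (a * b) + 2 * dot u w * (a * c) + 2 * dot v w * (b * c).
Proof. by rewrite /= !dotE !coordE; ring. Qed.

Lemma dot_scale (a : R) u : dot (a *: u) (a *: u) = a ^+ 2 * dot u u.
Proof. by rewrite !dotE !coordE; ring. Qed.

(** The inner products of [U] with [p] and [q] are [a * det3 p q r] and [b * det3 p q r], so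
    Cauchy-Schwarz is tight for both and [U] is parallel to both. *)
Lemma tight_combination_parallel p q r (a b c : R) :
    a ^+ 2 = dot p p -> b ^+ 2 = dot q q -> det3 p q r != 0 ->
    let U := a *: (q \x r) + b *: (r \x p) + c *: (p \x q) in
    dot U U = det3 p q r ^+ 2 -> p \x q = 0.
Proof.
move=> ap bq d0 U UU.
have Up : dot U p = a * det3 p q r.
  by rewrite /U /det3 !dotE !coordE; ring.
have Uq : dot U q = b * det3 p q r.
  by rewrite /U /det3 !dotE !coordE; ring.
have U0 : U != 0 by rewrite -dot_eq0 UU expf_neq0.
apply: (cross_trans0 U0); apply/eqP; rewrite -dot_eq0 lagrange_identity.
  by rewrite UU Up -ap; apply/eqP; ring.
by rewrite UU Uq -bq; apply/eqP; ring.
Qed.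

(** The vector [m] completes [p], [q] to a basis, so that inner products with all three determine
    [u]. If [p], [q], [r] are independent, [m = r] serves. Otherwise [r = al *: p + be *: q] gives a
    quadratic equation for [w], and [m] is the cross product of [p] and [q], for which a Gram
    determinant yields [dot m u ^ 2]. In both cases [Phi != 0] is seen at [w = 0], the case of
    points on the axis itself. *)
Lemma three_point_eliminant p q r :
    p \x q != 0 -> q \x r != 0 -> p \x r != 0 ->
  exists (Phi : {poly R}) (m : pt),
    [/\ Phi != 0, (size Phi <= 5)%N, det3 p q m != 0,
       (forall u (w : R), dot u u = 1 -> dot p p - w = dot p u ^+ 2 ->
          dot q q - w = dot q u ^+ 2 -> dot r r - w = dot r u ^+ 2 -> root Phi w) &
       (forall u v (w : R), dot u u = 1 -> dot v v = 1 -> dot p u = dot p v ->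
          dot q u = dot q v -> dot r r - w = dot r u ^+ 2 ->
          dot r r - w = dot r v ^+ 2 -> dot m u ^+ 2 = dot m v ^+ 2)].
Proof.
move=> pq qr pr; have [d0|d0] := eqVneq (det3 p q r) 0.
  pose n := p \x q; pose N2 := dot n n.
  have N0 : N2 != 0 by rewrite dot_eq0.
  have n0 : dot n r = 0 by [].
  pose al := dot (r \x q) n / N2; pose be := dot (p \x r) n / N2.
  have rE : r = al *: p + be *: q.
    apply: (scalerI N0).
    have -> : N2 *: r = dot (r \x q) n *: p + dot (p \x r) n *: q + dot n r *: n.
      by rewrite /N2 /n; apply: row3P; rewrite !dotE !coordE; split; ring.
    by rewrite n0 scale0r addr0 scalerDr !scalerA ![N2 * _]mulrC !divfK.
  have al0 : al != 0.
    apply: contra_neq qr => al0; rewrite rE al0 scale0r add0r.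
    by apply: row3P; rewrite !coordE; split; ring.
  have be0 : be != 0.
    apply: contra_neq pr => be0; rewrite rE be0 scale0r addr0.
    by apply: row3P; rewrite !coordE; split; ring.
  clearbody al be.
  pose A := (dot p p)%:P - 'X : {poly R}; pose B := (dot q q)%:P - 'X : {poly R}.
  pose C := (dot r r)%:P - 'X : {poly R}.
  pose s := C - (al ^+ 2)%:P * A - (be ^+ 2)%:P * B.
  pose Phi := s * s - (4 * (al ^+ 2 * be ^+ 2))%:P * (A * B).
  have rrE : dot r r = al ^+ 2 * dot p p + be ^+ 2 * dot q q + 2 * (al * be) * dot p q.
    by rewrite rE !dotE !coordE; ring.
  exists Phi, n; split.
  - suff : Phi.[0] != 0 by apply: contra_neq => ->; rewrite horner0.
    have -> : Phi.[0] = - (4 * (al ^+ 2 * be ^+ 2) * N2).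
      rewrite /N2 /n lagrange_identity /Phi /s /A /B /C.
      rewrite !(hornerD, hornerN, hornerM, hornerC, hornerX) rrE.
      ring.
    rewrite oppr_eq0 !mulf_neq0 ?expf_neq0 //.
    by rewrite (pnatr_eq0 R 4).
  - have sXC c : (size (c%:P - 'X : {poly R})%R <= 2)%N.
      by rewrite -opprB size_polyN size_XsubC.
    have sCM c (a : {poly R}) d : (size a <= d.+1)%N -> (size (c%:P * a)%R <= d.+1)%N.
      by move=> sa; apply: (@size_polyM_leq _ _ 0 d); rewrite ?size_polyC_leqS.
    have ss : (size s <= 2)%N.
      apply: size_polyD_leq; last by rewrite size_polyN; apply/sCM/sXC.
      by apply: size_polyD_leq; [apply: sXC | rewrite size_polyN; apply/sCM/sXC].
    apply: (@leq_trans 3) => //; apply: size_polyD_leq.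
      exact: (@size_polyM_leq _ _ 1 1).
    by rewrite size_polyN; apply: sCM; apply: (@size_polyM_leq _ _ 1 1); apply: sXC.
  - by [].
  - move=> u w u1 ep eq er; rewrite /root /Phi /s /A /B /C.
    rewrite !(hornerD, hornerN, hornerM, hornerC, hornerX) ep eq er.
    have -> : dot r u = al * dot p u + be * dot q u by rewrite rE !dotE !coordE; ring.
    by apply/eqP; ring.
  - move=> u v w u1 v1 ep eq _ _.
    have nE t : dot n t ^+ 2 = dot p p * dot q q * dot t t
        + 2 * dot p q * dot p t * dot q t - dot p p * dot q t ^+ 2
        - dot q q * dot p t ^+ 2 - dot p q ^+ 2 * dot t t.
      by rewrite /n !dotE !coordE; ring.
    by rewrite !nE u1 v1 ep eq.
pose c1 := q \x r; pose c2 := r \x p; pose c3 := p \x q.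
exists (cylinder_eliminant (dot p p) (dot q q) (dot r r) (det3 p q r ^+ 2)
  (dot c1 c1) (dot c2 c2) (dot c3 c3) (dot c1 c2) (dot c1 c3) (dot c2 c3)), r; split=> //.
- apply/negP => /eqP Phi0.
  have sq v : Num.sqrt (dot v v) ^+ 2 = dot v v by rewrite sqr_sqrtr // dot_ge0.
  have := @cylinder_eliminant_factor (dot p p) (dot q q) (dot r r) (det3 p q r ^+ 2)
    (dot c1 c1) (dot c2 c2) (dot c3 c3) (dot c1 c2) (dot c1 c3) (dot c2 c3) 0
    (Num.sqrt (dot p p)) (Num.sqrt (dot q q)) (Num.sqrt (dot r r)).
  rewrite !subr0 => /(_ (esym (sq p)) (esym (sq q)) (esym (sq r))) /=.
  rewrite Phi0 horner0.
  move: (Num.sqrt (dot p p)) (Num.sqrt (dot q q)) (Num.sqrt (dot r r)) (sq p) (sq q).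
  move=> a b c ap bq /esym/eqP.
  (* Each of the four factors at [w = 0] vanishes only if the combination is tight for some choice
     of signs of [a], [b], [c]. *)
  have tight a' b' c' : a' ^+ 2 = dot p p -> b' ^+ 2 = dot q q ->
      dot (a' *: c1 + b' *: c2 + c' *: c3) (a' *: c1 + b' *: c2 + c' *: c3)
      != det3 p q r ^+ 2.
    move=> ap' bq'; apply/eqP => /(tight_combination_parallel ap' bq' d0).
    by apply/eqP.
  rewrite !mulf_eq0 -!orbA => /or4P[] /eqP e.
  + by have /eqP := tight a b c ap bq; apply; rewrite dot_sum3; lra.
  + have := tight a b (- c) ap bq; apply/negP; rewrite negbK; apply/eqP.
    by rewrite dot_sum3; lra.
  + have bq' : (- b) ^+ 2 = dot q q by rewrite sqrrN.
    have := tight a (- b) c ap bq'; apply/negP; rewrite negbK; apply/eqP.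
    by rewrite dot_sum3; lra.
  + have ap' : (- a) ^+ 2 = dot p p by rewrite sqrrN.
    have := tight (- a) b c ap' bq; apply/negP; rewrite negbK; apply/eqP.
    by rewrite dot_sum3; lra.
- exact: size_cylinder_eliminant.
- move=> u w u1 ep eq er; rewrite /root (cylinder_eliminant_factor _ _ _ _ _ _ _ ep eq er).
  rewrite /=; set F1 := (X in X * _ * _ * _).
  suff -> : F1 = 0 by rewrite !mul0r.
  have := dot_scale (det3 p q r) u; rewrite u1 mulr1 cramer3 dot_sum3 -/c1 -/c2 -/c3.
  by rewrite /F1 => <-; ring.
- by move=> u v w _ _ _ _ <- <-.
Qed.

(* At most four radii, and each radius determines the axis up to three signs. *)
Lemma three_points_cylinders p q r (bs : seq pt) :
    p \x q != 0 -> q \x r != 0 -> p \x r != 0 -> uniq bs -> 0 \notin bs ->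
    {in bs &, forall b c, b != c -> b \x c != 0} ->
    {in bs, forall b, let w := dot (b \x p) (b \x p) in
       dot (b \x q) (b \x q) = w /\ dot (b \x r) (b \x r) = w} ->
  (size bs <= 32)%N.
Proof.
move=> pq qr pr ubs nz indep lev.
have [Phi [m [Phi0 sPhi d0 rootPhi sqm]]] := three_point_eliminant pq qr pr.
pose nb (b : pt) : R := Num.sqrt (dot b b); pose u (b : pt) : pt := (nb b)^-1 *: b.
pose w (b : pt) : R := dot (b \x p) (b \x p) / dot b b.
have bb b : b \in bs -> 0 < dot b b.
  move=> bin; rewrite lt_neqAle dot_ge0 andbT eq_sym dot_eq0.
  by apply: contraNneq nz => <-.
have nb0 b : b \in bs -> nb b != 0 by move=> /bb b0; rewrite gt_eqF // sqrtr_gt0.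
have nb2 b : nb b ^+ 2 = dot b b by rewrite sqr_sqrtr // dot_ge0.
have uu b : b \in bs -> dot (u b) (u b) = 1.
  by move=> bin; rewrite dot_scale exprVn nb2 mulVf // gt_eqF // bb.
have dotu b t : dot t (u b) = dot t b / nb b.
  by rewrite /u !dotE !coordE; ring.
have wE b t : b \in bs -> dot (b \x t) (b \x t) = dot (b \x p) (b \x p) ->
    dot t t - w b = dot t (u b) ^+ 2.
  move=> bin e; rewrite /w -e dotu expr_div_n nb2 lagrange_identity.
  have b0 : dot b b != 0 by rewrite gt_eqF // bb.
  have -> : dot b t = dot t b by rewrite !dotE; ring.
  by field.
have wp b : b \in bs -> dot p p - w b = dot p (u b) ^+ 2 by move=> bin; apply: wE.
have wq b : b \in bs -> dot q q - w b = dot q (u b) ^+ 2.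
  by move=> bin; apply: wE => //; have [] := lev b bin.
have wr b : b \in bs -> dot r r - w b = dot r (u b) ^+ 2.
  by move=> bin; apply: wE => //; have [] := lev b bin.
pose code b := (w b, (0 <= dot p (u b), (0 <= dot q (u b), 0 <= dot m (u b)))).
have sq_sign (a b : R) : a ^+ 2 = b ^+ 2 -> (0 <= a) = (0 <= b) -> a = b.
  move=> /eqP; rewrite eqf_sqr => /orP[/eqP//|/eqP->].
  rewrite oppr_ge0 => sgn; have [b0|b0] := leP 0 b.
    by have : b <= 0 by [rewrite sgn]; lra.
  by move: sgn; rewrite (ltW b0) leNgt b0.
have code_inj : {in bs &, injective code}.
  move=> b c bin cin [we sp sq sm]; apply/eqP; apply: contraT => bc.
  have ep : dot p (u b) = dot p (u c).
    by apply: sq_sign => //; rewrite -!wp // we.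
  have eq : dot q (u b) = dot q (u c).
    by apply: sq_sign => //; rewrite -!wq // we.
  have em : dot m (u b) = dot m (u c).
    apply: sq_sign => //; apply: (sqm _ _ (w b)); rewrite ?uu ?wr //.
    by rewrite -!wr // we.
  have ue : u b = u c.
    by apply: (scalerI d0); rewrite !cramer3 ep eq em.
  have : b \x c = 0.
    have -> : b = nb b *: u b by rewrite scalerA divff ?nb0 // scale1r.
    have -> : c = nb c *: u c by rewrite scalerA divff ?nb0 // scale1r.
    by rewrite ue; apply: row3P; rewrite !coordE; split; ring.
  by move/eqP; rewrite (negbTE (indep _ _ bin cin bc)).
pose ws := undup [seq w b | b <- bs].
have sws : (size ws <= 4)%N.
  rewrite -ltnS; apply: leq_trans sPhi; apply: max_poly_roots => //; last exact: undup_uniq.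
  apply/allP => x; rewrite mem_undup => /mapP[b bin ->].
  by apply: (rootPhi (u b)); rewrite ?uu ?wp ?wq ?wr.
pose bl := [:: true; false].
pose box := allpairs pair ws (allpairs pair bl (allpairs pair bl bl)).
have sbox : (size box <= 32)%N.
  by rewrite !size_allpairs; apply: (leq_mul sws (leqnn 8)).
apply: leq_trans sbox; rewrite -(size_map code); apply: uniq_leq_size.
  by rewrite map_inj_in_uniq.
move=> _ /mapP[b bin ->]; rewrite /code /box allpairs_f //.
  by rewrite mem_undup map_f.
by do !apply: allpairs_f; rewrite !inE; case: (0 <= _).
Qed.

End ThreeCylinders.

(** * Levels around many axes *)

Local Open Scope nat_scope.

Lemma count_sum (T : Type) (a : pred T) (s : seq T) : count a s = \sum_(x <- s) a x.
Proof. by rewrite -sum1_count big_mkcond; apply: eq_bigr => x _; case: (a x). Qed.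

Lemma leq_sum_seq_in (T : eqType) (s : seq T) (F F' : T -> nat) :
  {in s, forall x, F x <= F' x} -> \sum_(x <- s) F x <= \sum_(x <- s) F' x.
Proof. by move=> le_F; rewrite !big_seq; apply: leq_sum => x /le_F. Qed.

Lemma sum_cst_seq (T : Type) (s : seq T) k : \sum_(x <- s) k = size s * k.
Proof. by rewrite big_const_seq count_predT iter_addn addn0 mulnC. Qed.

Lemma covered_size (T U : eqType) (s : seq T) (Z : seq U) (P : U -> pred T) :
    {in s, forall x, exists2 c, c \in Z & P c x} ->
  size s <= \sum_(c <- Z) count (P c) s.
Proof.
move=> cov; under eq_bigr => c _ do rewrite count_sum.
rewrite exchange_big -[size s]muln1 -sum_cst_seq; apply: leq_sum_seq_in => x /cov[c cZ Pcx].
by rewrite (big_rem c) //= Pcx.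
Qed.

Lemma distinct_triples_ge (T : eqType) (s : seq T) : uniq s ->
  size s * (size s).-1 * (size s).-2 <=
  \sum_(x <- s) \sum_(y <- s) \sum_(z <- s) [&& x != y, y != z & x != z].
Proof.
move=> us.
have cnt1 x : (size s).-1 <= count (fun y => x != y) s.
  rewrite -(count_predC (fun y => x == y) s) -subn1 leq_subLR leq_add2r.
  rewrite (eq_count (a2 := pred1 x)) => [|y]; last by rewrite /= eq_sym.
  by rewrite count_uniq_mem // leq_b1.
have cnt2 x y : (size s).-2 <= count (fun z => (y != z) && (x != z)) s.
  have : size s <= count (fun z => (y != z) && (x != z)) s
      + (count_mem x s + count_mem y s).
    rewrite -[size s]muln1 -sum_cst_seq !count_sum -!big_split; apply: leq_sum => z _ /=.
    by rewrite eq_sym [x == z]eq_sym; case: (z == y); case: (z == x).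
  by rewrite !count_uniq_mem //; move: (leq_b1 (x \in s)) (leq_b1 (y \in s)); lia.
rewrite -mulnA -sum_cst_seq; apply: leq_sum => x _.
apply: leq_trans (leq_mul (cnt1 x) (leqnn _)) _.
rewrite count_sum big_distrl /=; apply: leq_sum => y _.
case: (x != y) => /=; last by rewrite mul0n.
by rewrite mul1n -count_sum; apply: cnt2.
Qed.

Lemma seq_has_max (R : realType) (s : seq R) : s != [::] ->
  exists2 m, m \in s & {in s, forall x, (x <= m)%R}.
Proof.
elim: s => // x [|y s] IHs _.
  by exists x; rewrite ?mem_head // => z; rewrite inE => /eqP->.
have [//|m ms mle] := IHs; have [xm|mx] := leP x m.
  exists m; first by rewrite inE ms orbT.
  by move=> z; rewrite inE => /predU1P[->|/mle].
exists x; first exact: mem_head.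
move=> z; rewrite inE => /predU1P[->//|/mle zm]; exact: le_trans zm (ltW mx).
Qed.

Lemma seq_has_min (R : realType) (s : seq R) : s != [::] ->
  exists2 m, m \in s & {in s, forall x, (m <= x)%R}.
Proof.
move=> s0; have [|m] := @seq_has_max R [seq - x | x <- s]%R.
  by case: s s0.
move=> /mapP[x xs ->] xle; exists x => // y ys.
by have := xle _ (map_f _ ys); rewrite lerN2.
Qed.

Section Window.
Variables (R : realType) (V : seq R) (fc : R) (h : nat).
Local Open Scope ring_scope.

Definition level_gap (v : R) : nat := count (fun t => (t <= v) != (t <= fc)) V.

Lemma window_above (W : seq R) :
    {in W, forall v, fc < v /\ (level_gap v <= h)%N} ->
  (count (fun t => has (fun v => (fc < t)%R && (t <= v)%R) W) V <= h)%N.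
Proof.
have [->|W0] := eqVneq W [::]; first by rewrite count_pred0.
move=> gap; have [m mW mle] := seq_has_max W0; have [cm] := gap m mW.
apply: leq_trans; apply: sub_count => t /hasP[v vW /andP[ct tv]].
by rewrite /= (le_trans tv (mle v vW)) leNgt ct.
Qed.

Lemma window_below (W : seq R) :
    {in W, forall v, v < fc /\ (level_gap v <= h)%N} ->
  (count (fun t => has (fun v => (v < t)%R && (t <= fc)%R) W) V <= h)%N.
Proof.
have [->|W0] := eqVneq W [::]; first by rewrite count_pred0.
move=> gap; have [m mW mle] := seq_has_min W0; have [mc] := gap m mW.
apply: leq_trans; apply: sub_count => t /hasP[v vW /andP[vt tc]].
by rewrite /= tc leNgt (le_lt_trans (mle v vW) vt).
Qed.

(** Levels of [W] are themselves thresholds, so those above [fc] all separate the highest one from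
    [fc]: at most [h]. Below [fc] the lowest level does not separate itself, which allows [h.+1];
    and [fc] may be a level too. *)
Lemma window_levels (W : seq R) : uniq W -> {subset W <= V} ->
  {in W, forall v, (level_gap v <= h)%N} -> (size W <= h.+1.*2)%N.
Proof.
move=> uW WV gap.
pose hi := [seq v <- W | fc < v]; pose lo := [seq v <- W | v < fc].
have sizeE : size W = (size hi + size lo + count_mem fc W)%N.
  rewrite !size_filter !count_sum -[LHS]muln1 -sum_cst_seq -!big_split.
  by apply: eq_bigr => v _ /=; case: ltgtP.
have sub_size (s : seq R) (P : pred R) : uniq s -> {subset s <= V} -> {in s, forall t, P t} ->
    (size s <= count P V)%N.
  move=> us sV sP; rewrite -size_filter; apply: uniq_leq_size => // t ts.
  by rewrite mem_filter sP // sV.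
have le_hi : (size hi <= h)%N.
  apply: leq_trans (window_above (W := hi) _) => [|v].
    apply: sub_size; first exact: filter_uniq.
      by move=> t; rewrite mem_filter => /andP[_ /WV].
    move=> t thi; apply/hasP; exists t => //; rewrite lexx andbT.
    by move: thi; rewrite mem_filter => /andP[].
  by rewrite mem_filter => /andP[vc vW]; split=> //; apply: gap.
have le_lo : (size lo <= h.+1)%N.
  have [->//|lo0] := eqVneq lo [::].
  have [m mlo mle] := seq_has_min lo0.
  have ulo : uniq lo by apply: filter_uniq.
  rewrite -(prednK (n := size lo)); last by case: (lo) lo0.
  rewrite ltnS -(size_rem mlo); apply: leq_trans (window_below (W := lo) _) => [|v].
    apply: sub_size; first exact: rem_uniq.
      by move=> t /mem_rem; rewrite mem_filter => /andP[_ /WV].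
    move=> t; rewrite mem_rem_uniq // inE => /andP[tm tlo]; apply/hasP; exists m => //.
    rewrite lt_neqAle eq_sym tm mle //=.
    by move: tlo; rewrite mem_filter => /andP[/ltW].
  by rewrite mem_filter => /andP[vc vW]; split=> //; apply: gap.
have : (count_mem fc W <= 1)%N by rewrite count_uniq_mem // leq_b1.
by rewrite sizeE -addnn; lia.
Qed.

End Window.

Section Axes.
Variable R : realType.
Local Notation pt := 'rV[R]_3.

(** The squared distance of [p] from the axis spanned by [b], times [dot b b]. The factor is
    constant for each axis, and the value is four times the squared area of the triangle [0 b p]. *)
Definition axis_value (b p : pt) : R :=
  dot (cross_product b p) (cross_product b p).

Definition axis_values (B : seq pt) (b : pt) : seq R :=
  undup [seq axis_value b p | p <- B].

Local Notation gap B c b p :=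
  (level_gap (axis_values B b) (axis_value b c) (axis_value b p)).

(* Kovari-Sos-Turan for triples of points on a common cylinder. *)
Lemma ball_small (B G : seq pt) c h T r :
    uniq B -> (0%R : pt) \notin B ->
    {in B &, forall b b', b != b' -> cross_product b b' != 0%R} ->
    uniq G -> {subset G <= B} -> c \in B -> 0 < T -> 4 <= size B ->
    {in G, forall p, r * \sum_(b <- B) gap B c b p <= size B * T} ->
    4 * T <= r * h.+1 -> 512 * 64 * (h.+1.*2) ^ 2 < size B ->
  size G < 16 * h.+1.*2.
Proof.
move=> uB B0 indep uG GB cB T0 L4 near Tr Lh.
set L := size B in L4 near Lh *; set H := h.+1.*2 in Lh *.
pose good (b p : pt) := (gap B c b p <= h) && (p != b).
(* By Markov, [4 * T <= r * h.+1] leaves at most a quarter of the axes with gap above [h]. *)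
have good_ge p : p \in G -> L <= 2 * count (good^~ p) B.
  move=> pG.
  have bad4 : 4 * count (fun b => h < gap B c b p) B <= L.
    have lb : h.+1 * count (fun b => h < gap B c b p) B <= \sum_(b <- B) gap B c b p.
      rewrite count_sum big_distrr /=; apply: leq_sum => b _.
      by case: ltnP => /= hb; rewrite ?muln1 ?muln0.
    rewrite -(@leq_pmul2r T) //; apply: leq_trans (near p pG).
    apply: leq_trans (_ : r * (h.+1 * count (fun b => h < gap B c b p) B) <= _).
      by rewrite mulnA; move: Tr; nia.
    by rewrite leq_mul2l lb orbT.
  have : L <= count (good^~ p) B + count (fun b => h < gap B c b p) B + count_mem p B.
    rewrite /L -[size B]muln1 -sum_cst_seq !count_sum -!big_split; apply: leq_sum => b _.
    by rewrite /good /= [b == p]eq_sym; case: (leqP (gap B c b p) h); case: (p == b).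
  have : count_mem p B <= 1 by rewrite count_uniq_mem // leq_b1.
  by lia.
pose lev b := undup [seq axis_value b p | p <- [seq p <- G | good b p]].
pose cls b v := [seq p <- G | good b p && (axis_value b p == v)].
have size_lev b : b \in B -> size (lev b) <= H.
  move=> bB; apply: (@window_levels R (axis_values B b) (axis_value b c)); first exact: undup_uniq.
    move=> v; rewrite mem_undup => /mapP[p]; rewrite mem_filter => /andP[_ /GB pB] ->.
    by rewrite mem_undup map_f.
  move=> v; rewrite mem_undup => /mapP[p]; rewrite mem_filter => /andP[gp _] ->.
  by have /andP[] := gp.
have cls_sum b : \sum_(v <- lev b) size (cls b v) = count (good b) G.
  under eq_bigr => v _ do rewrite size_filter count_sum.
  rewrite exchange_big count_sum; apply: eq_big_seq => p pG /=.
  have [gp|_] := boolP (good b p); last by rewrite /= big1.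
  rewrite /= -count_sum (eq_count (a2 := pred1 (axis_value b p))) => [|v]; last exact: eq_sym.
  rewrite count_uniq_mem ?undup_uniq // mem_undup map_f // mem_filter gp.
  by rewrite pG.
have triples : \sum_(b <- B) \sum_(v <- lev b)
    size (cls b v) * (size (cls b v)).-1 * (size (cls b v)).-2 <= 32 * size G ^ 3.
  pose same b p q s := [&& [&& p != q, q != s & p != s], [&& good b p, good b q & good b s],
    axis_value b q == axis_value b p & axis_value b s == axis_value b p].
  apply: leq_trans (_ : \sum_(b <- B) \sum_(p <- G) \sum_(q <- G) \sum_(s <- G) same b p q s <= _).
    apply: leq_sum => b _.
    apply: leq_trans (_ : \sum_(v <- lev b) \sum_(p <- G) \sum_(q <- G) \sum_(s <- G)
        (same b p q s && (axis_value b p == v)) <= _).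
      apply: leq_sum => v _.
      apply: leq_trans (distinct_triples_ge (filter_uniq _ uG)) _.
      rewrite /cls big_filter [leqLHS]big_mkcond; apply: leq_sum => p _ /=.
      have [/andP[gp /eqP pv]|_] := boolP (good b p && _) => //.
      rewrite big_filter [leqLHS]big_mkcond; apply: leq_sum => q _ /=.
      have [/andP[gq /eqP qv]|_] := boolP (good b q && _) => //.
      rewrite big_filter [leqLHS]big_mkcond; apply: leq_sum => s _ /=.
      have [/andP[gs /eqP sv]|_] := boolP (good b s && _) => //.
      by rewrite /same gp gq gs pv qv sv eqxx !andbT.
    rewrite exchange_big; apply: leq_sum => p _; rewrite exchange_big; apply: leq_sum => q _.
    rewrite exchange_big; apply: leq_sum => s _ /=; case: (same b p q s) => /=; last by rewrite big1.
    rewrite -count_sum (eq_count (a2 := pred1 (axis_value b p))) => [|v]; last exact: eq_sym.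
    by rewrite count_uniq_mem ?undup_uniq // leq_b1.
  rewrite exchange_big; under eq_bigr => p _ do rewrite exchange_big.
  have -> : 32 * size G ^ 3 = \sum_(p <- G) \sum_(q <- G) \sum_(s <- G) 32.
    by rewrite !sum_cst_seq !expnS; lia.
  apply: leq_sum_seq_in => p pG; apply: leq_sum_seq_in => q qG.
  rewrite exchange_big; apply: leq_sum_seq_in => s sG.
  rewrite -count_sum -size_filter.
  have [->//|] := eqVneq (size [seq b <- B | same b p q s]) 0.
  rewrite -lt0n => bs0.
  have [b0 b0P] : exists b0, b0 \in [seq b <- B | same b p q s].
    by case: [seq b <- B | _] bs0 => // b0 bs _; exists b0; rewrite mem_head.
  have /and3P[pq qs ps] : [&& p != q, q != s & p != s].
    by move: b0P; rewrite mem_filter => /andP[/andP[]].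
  apply: (@three_points_cylinders R p q s); rewrite ?indep ?GB ?filter_uniq //.
  - by rewrite mem_filter negb_and B0 orbT.
  - by move=> b b'; rewrite !mem_filter => /andP[_ bB] /andP[_ b'B]; apply: indep.
  - by move=> b; rewrite mem_filter => /andP[/and4P[_ _ /eqP eq_q /eqP eq_s] _].
(* A substitute for Hoelder's inequality: a class has at most [k] points, or its triples pay for
   [k ^ 2 * c']. *)
have cube k c' : 4 <= k -> k ^ 2 * c' <= 4 * (c' * c'.-1 * c'.-2) + k ^ 3.
  move=> k4; have [ck|kc] := leqP c' k; first by rewrite [k ^ 3]expnSr; nia.
  have c3 : c' ^ 2 <= 4 * (c'.-1 * c'.-2) by case: c' kc => [|[|c']] //=; nia.
  have : k ^ 2 <= c' ^ 2 by rewrite leq_exp2r // ltnW.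
  by move: c3; move: (k ^ 2) (c' ^ 2) (c'.-1) (c'.-2) (k ^ 3) => a b x y z; nia.
have total k : 4 <= k ->
    k ^ 2 * \sum_(b <- B) count (good b) G <= 128 * size G ^ 3 + k ^ 3 * (L * H).
  move=> k4.
  apply: leq_trans (_ : \sum_(b <- B) \sum_(v <- lev b)
    (4 * (size (cls b v) * (size (cls b v)).-1 * (size (cls b v)).-2) + k ^ 3) <= _).
    rewrite big_distrr /=; apply: leq_sum => b _; rewrite -cls_sum big_distrr /=.
    by apply: leq_sum => v _; apply: cube.
  under eq_bigr => b _ do rewrite big_split -big_distrr /= sum_cst_seq.
  rewrite big_split -big_distrr /=; apply: leq_add.
    by apply: leq_trans (leq_mul (leqnn 4) triples) _; rewrite mulnA.
  rewrite -big_distrl /= mulnC leq_mul2l; apply/orP; right.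
  by rewrite -sum_cst_seq; apply: leq_sum_seq_in.
have swap : size G * L <= 2 * \sum_(b <- B) count (good b) G.
  under eq_bigr => b _ do rewrite count_sum.
  rewrite exchange_big big_distrr /= -sum_cst_seq; apply: leq_sum_seq_in => p pG.
  by rewrite -count_sum; apply: good_ge.
rewrite ltnNge; apply/negP => bigG.
have H0 : 0 < 4 * H by rewrite /H.
(* For this [k] the term [k ^ 3 * (L * H)] accounts for at most half of the incidences. The triples
   must provide the rest, which bounds [L] by a multiple of [H ^ 2]. *)
pose k := size G %/ (4 * H).
have k4 : 4 <= k by rewrite leq_divRL // mulnA.
have kle : k * (4 * H) <= size G by apply: leq_trunc_div.
have klt : size G < k.+1 * (4 * H) by rewrite -ltn_divLR.
have {total} := total k k4; move: swap kle klt Lh.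
move: (\sum_(b <- B) _) => I; move: (size G) (L) (H) {bigG} H0 => g l H' H0.
move=> swap kle klt Lh tot.
have g0 : 0 < g by nia.
have gk : g <= 8 * H' * k by nia.
have t1 : k ^ 2 * (g * l) <= 256 * g ^ 3 + 2 * (k ^ 3 * (l * H')).
  by move: tot swap; move: (k ^ 2) (g ^ 3) (k ^ 3 * _) => a b d; nia.
have t2 : 4 * (k ^ 3 * (l * H')) <= k ^ 2 * (l * g).
  by rewrite expnSr; move: (k ^ 2) kle => a; nia.
have t3 : k ^ 2 * l <= 512 * g ^ 2.
  have : k ^ 2 * (g * l) <= 512 * g ^ 3.
    by move: t1 t2; rewrite [l * g]mulnC; move: (k ^ 3 * _) (k ^ 2 * _) (g ^ 3) => a b d; lia.
  have <- : k ^ 2 * l * g = k ^ 2 * (g * l) by rewrite -mulnA [l * g]mulnC.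
  have <- : 512 * g ^ 2 * g = 512 * g ^ 3 by rewrite -mulnA -expnSr.
  by rewrite leq_pmul2r.
have t4 : g ^ 2 <= 64 * H' ^ 2 * k ^ 2.
  by apply: leq_trans (_ : (8 * H' * k) ^ 2 <= _); rewrite ?leq_exp2r // !expnMn.
have k2 : 0 < k ^ 2 by rewrite expn_gt0 (leq_trans _ k4).
have : k ^ 2 * l <= k ^ 2 * (512 * 64 * H' ^ 2).
  by apply: leq_trans t3 _; move: t4; move: (g ^ 2) (H' ^ 2) (k ^ 2) => a b d; nia.
by rewrite leq_pmul2l // leqNgt Lh.
Qed.

Lemma axis_level_poly_fun (b : pt) (th : R) :
  exists2 f : pt -> R, poly_fun 2 f & forall p,
    (0%R < f p)%R = (th < axis_value b p)%R /\ (f p == 0%R) = (axis_value b p == th).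
Proof.
exists (fun p => axis_value b p + - th)%R.
  apply: poly_funD; last exact: poly_fun_const.
  apply: (poly_fun_ext (f := fun p => (\sum_(i <- index_enum 'I_3)
     cross_product b p 0 i * cross_product b p 0 i)%R)) => //.
  apply: poly_fun_sum => i; apply: (@poly_funM _ _ 1 1);
  apply: (poly_fun_ext (f := fun p : pt => (b 0 (i + 1) * p 0 (i + 2%:R)
      + - b 0 (i + 2%:R) * p 0 (i + 1))%R)) => [p|];
  rewrite ?mxE ?mulNr //; apply: poly_funD; apply: poly_funZ; exact: poly_funX.
by move=> p; rewrite subr_gt0 subr_eq0.
Qed.

End Axes.

Lemma axes_levels : exists C : nat, forall (R : realType) (B : seq 'rV[R]_3) T,
    uniq B -> 0%R \notin B ->
    {in B &, forall b b', b != b' -> cross_product b b' != 0%R} ->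
    {in B, forall b, size (axis_values B b) <= T} ->
  size B ^ 2 <= C * T ^ 3.
Proof.
have [C1 cover] := level_cover.
(* [K] rewrites the size condition of [ball_small] as [K * h.+1 ^ 2 < size B]. In [M], 32 comes from
   the ball size [32 * h.+1] and 125 from [(5 * T) ^ 3]. *)
have [K KE] : exists K, K = 512 * 64 * 4 by eexists.
have [M ME] : exists M, M = 32 * 125 by eexists.
(* One summand per case: [size B <= 4 * K]; then [h.+1 <= T], the main case; then [T < h.+1], where
   [size B] is bounded by a constant. *)
exists ((4 * K) ^ 2 + 4 * K * (M * C1) + ((M * C1) ^ 2 * (4 * K)) ^ 2) => R B T uB B0 indep leT.
have [->|] := posnP (size B); first by rewrite exp0n.
case EB : (B) => [//|b0 B'] _; rewrite -EB.
have T0 : 0 < T.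
  have b0B : b0 \in B by rewrite EB mem_head.
  apply: leq_trans (leT b0 b0B); case E : (axis_values B b0) => //.
  have : axis_value b0 b0 \in axis_values B b0 by rewrite mem_undup map_f.
  by rewrite E.
have T3 : 0 < T ^ 3 by rewrite expn_gt0 T0.
have small X Y : X <= Y -> X <= Y * T ^ 3 by move=> XY; apply: leq_trans XY _; rewrite leq_pmulr.
have [LK|KL] := leqP (size B) (4 * K).
  rewrite -addnA mulnDl; apply: leq_trans (leq_addr _ _).
  by apply: small; rewrite leq_exp2r.
have exh : exists h, K * h.+1 ^ 2 < size B by exists 0; rewrite exp1n muln1; lia.
have bndh h : K * h.+1 ^ 2 < size B -> h <= size B.
  have : 0 < K by rewrite KE.
  by move=> K0 /ltnW; apply: leq_trans; rewrite -[h]mul1n leq_mul // expnS; nia.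
(* [h] is about [sqrt (size B / K)], as large as [ball_small] permits. *)
case: (ex_maxnP exh bndh) => h hB hmax.
have hB' : size B <= 4 * K * h.+1 ^ 2.
  have : size B <= K * h.+2 ^ 2.
    by rewrite leqNgt; apply/negP => /hmax; rewrite ltnn.
  move/leq_trans; apply; rewrite [4 * K]mulnC -mulnA leq_mul2l; apply/orP; right.
  by rewrite -[4]/(2 ^ 2) -expnMn leq_exp2r //; lia.
pose r := (4 * T) %/ h.+1 + 1.
have r0 : 0 < r by rewrite /r addn1.
have rlo : 4 * T <= r * h.+1.
  by rewrite /r addn1 ltnW // -ltn_divLR.
have rhi : r * h.+1 <= 4 * T + h.+1.
  by rewrite /r mulnDl mul1n leq_add2r leq_trunc_div.
have [|Z [ZB sZ cov]] := cover R _ B (axis_values B) (@axis_value R) B r r0.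
  move=> b th _; have [f pf fP] := axis_level_poly_fun b th; exists f => // p _; exact: fP.
have sumT : \sum_(b <- B) size (axis_values B b) <= size B * T.
  by rewrite -sum_cst_seq; apply: leq_sum_seq_in.
pose near c p := r * \sum_(b <- B)
  level_gap (axis_values B b) (axis_value b c) (axis_value b p) <= size B * T.
have L4 : 4 <= size B by have : 0 < K by [rewrite KE]; lia.
have groups : size B <= size Z * (32 * h.+1).
  apply: leq_trans (@covered_size _ _ B Z near _) _.
    by move=> p pB; have [c cZ cp] := cov p pB; exists c => //; apply: leq_trans cp sumT.
  rewrite -sum_cst_seq; apply: leq_sum_seq_in => c cZ.
  rewrite -size_filter; apply: ltnW.
  have -> : 32 * h.+1 = 16 * h.+1.*2 by lia.
  apply: (@ball_small R B _ c h T r) => //.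
  - exact: filter_uniq.
  - by move=> p; rewrite mem_filter => /andP[].
  - exact: ZB.
  - by move=> p; rewrite mem_filter => /andP[].
  - by apply: leq_ltn_trans hB; rewrite KE -mul2n expnMn; lia.
have {groups} main : size B * h.+1 ^ 2 <= 32 * C1 * (r * h.+1) ^ 3.
  apply: leq_trans (leq_mul groups (leqnn _)) _.
  apply: leq_trans (_ : C1 * r ^ 3 * (32 * h.+1) * h.+1 ^ 2 <= _).
    by rewrite !leq_mul2r sZ !orbT.
  by rewrite expnMn [h.+1 ^ 3]expnS; move: (r ^ 3) (h.+1 ^ 2) => x y; nia.
have [hT|Th] := leqP h.+1 T.
  have r5 : (r * h.+1) ^ 3 <= 125 * T ^ 3.
    by rewrite -[125]/(5 ^ 3) -expnMn leq_exp2r //; lia.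
  have m1 : size B * h.+1 ^ 2 <= M * C1 * T ^ 3.
    by apply: leq_trans main _; rewrite ME; move: r5; move: (_ ^ 3) (T ^ 3) => x y; nia.
  rewrite -addnA mulnDl mulnDl; apply: leq_trans (leq_addl _ _); apply: leq_trans (leq_addr _ _).
  rewrite expnS expn1; apply: leq_trans (leq_mul (leqnn _) hB') _.
  by move: m1; move: (h.+1 ^ 2) (T ^ 3) => x y; nia.
have r5 : r ^ 3 <= 125.
  rewrite -[125]/(5 ^ 3) leq_exp2r // -(@leq_pmul2r h.+1) //.
  by lia.
have h1 : h.+1 <= M * C1.
  have : size B <= M * C1 * h.+1.
    rewrite -(@leq_pmul2r (h.+1 ^ 2)) ?expn_gt0 //; apply: leq_trans main _.
    rewrite expnMn ME [h.+1 ^ 3]expnS.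
    by move: r5; move: (r ^ 3) (h.+1 ^ 2) => x y; nia.
  move=> B1; have : h.+1 ^ 2 <= M * C1 * h.+1.
    apply: leq_trans B1; apply: leq_trans (ltnW hB).
    by rewrite -[leqLHS]mul1n leq_mul2r KE.
  by rewrite expnS expn1 leq_pmul2r.
rewrite mulnDl; apply: leq_trans (leq_addl _ _); apply: small; rewrite leq_exp2r //.
apply: leq_trans hB' _; rewrite mulnC leq_mul2r leq_exp2r // h1.
by rewrite orbT.
Qed.

(** * A weak Dirac theorem *)

Local Open Scope ring_scope.

Lemma sum_inv_multiplicity (R : realType) (T U : eqType) (A : seq T) (f : T -> U) :
  \sum_(a <- A) ((count (fun a' => f a' == f a) A)%:R : R)^-1 =
  (size (undup [seq f a | a <- A]))%:R.
Proof.
pose F v : R := (count (fun a' => f a' == v) A)%:R^-1.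
transitivity (\sum_(a <- A) \sum_(v <- undup [seq f a | a <- A]) (f a == v)%:R * F v).
  apply: eq_big_seq => a aA; rewrite (bigD1_seq (f a)) ?undup_uniq //=; last first.
    by rewrite mem_undup map_f.
  by rewrite eqxx mul1r big1 ?addr0 // => v va; rewrite eq_sym (negbTE va) mul0r.
rewrite exchange_big -[in RHS](mul1n (size _)) -sum1_size big_distrr /= natr_sum.
apply: eq_big_seq => v; rewrite mem_undup => vA; rewrite -big_distrl /= -natr_sum -count_sum.
rewrite /F divff // pnatr_eq0 -lt0n -has_count.
by have /mapP[a aA ->] := vA; apply/hasP; exists a => /=.
Qed.

Section WindowWeight.
Variables (R : realType) (V V' : seq R) (fc : R) (h k : nat).

(** As in [window_levels], but a level counts with its multiplicity in [V']: the lowest level and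
    [fc] escape the thresholds, and each weighs at most [k]. In the application [V] also contains
    the default slope from a centre to itself. *)
Lemma window_weight (W : seq R) : uniq W ->
    (forall P : pred R, (count P V' <= count P V)%N) ->
    {in W, forall v, (count_mem v V' <= k)%N} ->
    {in W, forall v, (level_gap V fc v <= h)%N} ->
  (\sum_(v <- W) count_mem v V' <= (h + k).*2)%N.
Proof.
move=> uW V'V lek gap.
have sumE (s : seq R) : uniq s -> (\sum_(v <- s) count_mem v V' = count (mem s) V')%N.
  move=> us; under eq_bigr => v _ do rewrite count_sum.
  rewrite exchange_big [RHS]count_sum; apply: eq_bigr => t _ /=.
  by rewrite -count_sum -(count_uniq_mem _ us); apply: eq_count => v; rewrite /= eq_sym.
pose hi := [seq v <- W | fc < v]; pose lo := [seq v <- W | v < fc].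
have splitE : (\sum_(v <- W) count_mem v V' = \sum_(v <- hi) count_mem v V' +
    \sum_(v <- lo) count_mem v V' + \sum_(v <- W | v == fc) count_mem v V')%N.
  rewrite !big_filter [X in (X + _ + _)%N]big_mkcond [X in (_ + X + _)%N]big_mkcond.
  rewrite [X in (_ + X)%N]big_mkcond -!big_split /=; apply: eq_bigr => v _.
  by case: ltgtP; rewrite ?addn0.
have le_hi : (\sum_(v <- hi) count_mem v V' <= h)%N.
  rewrite sumE ?filter_uniq //; apply: leq_trans (V'V _) _.
  apply: leq_trans (window_above (fc := fc) (V := V) (W := hi) _) => [|v].
    apply: sub_count => t /= thi; apply/hasP; exists t => //; rewrite lexx andbT.
    by move: thi; rewrite mem_filter => /andP[].
  by rewrite mem_filter => /andP[vc vW]; split=> //; apply: gap.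
have le_lo : (\sum_(v <- lo) count_mem v V' <= h + k)%N.
  have [->|lo0] := eqVneq lo [::]; first by rewrite big_nil.
  have [m mlo mle] := seq_has_min lo0.
  have ulo : uniq lo by apply: filter_uniq.
  rewrite (big_rem m) //= addnC; apply: leq_add; last first.
    by apply: lek; move: mlo; rewrite mem_filter => /andP[].
  rewrite sumE ?rem_uniq //; apply: leq_trans (V'V _) _.
  apply: leq_trans (window_below (fc := fc) (V := V) (W := lo) _) => [|v].
    apply: sub_count => t /=; rewrite mem_rem_uniq // inE => /andP[tm tlo].
    apply/hasP; exists m => //; rewrite lt_neqAle eq_sym tm mle //=.
    by move: tlo; rewrite mem_filter => /andP[/ltW].
  by rewrite mem_filter => /andP[vc vW]; split=> //; apply: gap.
have le_eq : (\sum_(v <- W | v == fc) count_mem v V' <= k)%N.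
  have [fW|fW] := boolP (fc \in W).
    rewrite -big_filter (_ : [seq v <- W | v == fc] = [:: fc]) ?big_seq1; first exact: lek.
    by apply/perm_small_eq => //; apply: uniq_perm; rewrite ?filter_uniq // => v;
      rewrite mem_filter inE; case: eqP => // ->.
  by rewrite big_seq_cond big1 // => v /andP[vW /eqP e]; rewrite -e vW in fW.
by rewrite splitE -addnn; lia.
Qed.

End WindowWeight.

Section WeakDirac.
Variables (R : realType) (X Y : 'rV[R]_3 -> R) (S : seq 'rV[R]_3).
Local Notation pt := 'rV[R]_3.
Hypothesis uS : uniq S.
Hypothesis X_inj : {in S &, injective X}.

Definition slope (a x : pt) : R := (Y x - Y a) / (X x - X a).

Lemma slopeC a x : slope a x = slope x a.
Proof. by rewrite /slope -opprB -[X x - X a]opprB invrN mulrNN. Qed.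

Lemma slopeP a x s : a \in S -> x \in S -> a != x ->
  (slope a x == s) = (Y x - Y a == s * (X x - X a)).
Proof.
move=> aS xS ax; have nz : X x - X a != 0.
  by rewrite subr_eq0; apply: contra_neq ax => /(X_inj xS aS).
by rewrite -(inj_eq (mulIf nz)) /slope mulfVK.
Qed.

Lemma slope_trans a p q : a \in S -> p \in S -> q \in S ->
  a != p -> a != q -> p != q -> slope a p = slope a q -> slope p q = slope a p.
Proof.
move=> aS pS qS ap aq pq e; apply/eqP; rewrite slopeP //.
have /eqP e1 : Y p - Y a == slope a p * (X p - X a) by rewrite -slopeP.
have /eqP e2 : Y q - Y a == slope a p * (X q - X a) by rewrite e -slopeP.
have -> : Y q - Y p = (Y q - Y a) - (Y p - Y a) by ring.
by rewrite e1 e2; apply/eqP; ring.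
Qed.

Definition slopes (a : pt) : seq R := [seq slope a x | x <- S & x != a].

Variables (A G : seq pt) (c : pt) (h k r L : nat).
Hypothesis uA : uniq A.
Hypothesis AS : {subset A <= S}.
Hypothesis uG : uniq G.
Hypothesis GS : {subset G <= S}.
Hypothesis GA : {in G, forall p, p \notin A}.
Hypothesis thin : {in S &, forall a x, a != x -> (count_mem (slope a x) (slopes a) <= k)%N}.
Hypothesis leL : {in G, forall p, (size (undup (slopes p)) <= L)%N}.

Local Notation gap a p := (level_gap [seq slope a x | x <- S] (slope a c) (slope a p)).
Local Notation kappa a p := (count_mem (slope a p) (slopes a)).

Lemma kappaE a p :
  kappa a p = size [seq x <- S | (slope a x == slope a p) && (x != a)].
Proof. by rewrite /slopes count_map count_filter size_filter. Qed.

(** On the line [a p], trade [a], which [kappa] leaves out, for [p], which is not a centre. *)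
Lemma kappa_ge a p : a \in A -> p \in G ->
  (count (fun a' => slope p a' == slope p a) A <= kappa a p)%N.
Proof.
move=> aA pG; have pA := GA pG; have aS := AS aA; have pS := GS pG.
have ap : a != p by apply: contraNneq pA => <-.
rewrite kappaE -size_filter.
set s := [seq a' <- A | _].
have as_ : a \in s by rewrite mem_filter eqxx.
have us : uniq s by rewrite filter_uniq.
have -> : size s = size (p :: rem a s).
  by rewrite /= (size_rem as_) prednK //; case: (s) as_.
apply: uniq_leq_size.
  rewrite /= rem_uniq // andbT; apply: contra pA => /mem_rem.
  by rewrite mem_filter => /andP[].
move=> x; rewrite inE => /predU1P[->|]; first by rewrite mem_filter eqxx pS eq_sym ap.
rewrite mem_rem_uniq // inE mem_filter => /and3P[xa /eqP e xA].
rewrite mem_filter xa AS // !andbT; apply/eqP.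
have px : p != x by apply: contraNneq pA => ->.
have pa : p != a by rewrite eq_sym.
have ax : a != x by rewrite eq_sym.
rewrite [RHS]slopeC.
exact: (slope_trans pS aS (AS xA) pa px ax (esym e)).
Qed.

Lemma kappa_gt0 a p : a \in A -> p \in G -> (0 < kappa a p)%N.
Proof.
move=> aA pG; apply: leq_trans (kappa_ge aA pG); rewrite -has_count.
by apply/hasP; exists a.
Qed.

(** For [p != q] only the centres on the line [p q] contribute; if there are [m] of them, each
    weighs at most [1 / m]. For [p = q] the centres on each line through [p] weigh at most 1
    together, and there are at most [L] lines. *)
Lemma sum_inv_kappa p q : p \in G -> q \in G ->
  \sum_(a <- A) (slope a p == slope a q)%:R / (kappa a p)%:R <=
  (if p == q then L%:R else 1) :> R.
Proof.
move=> pG qG; have pS := GS pG; have qS := GS qG.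
have le_inv a : a \in A -> ((kappa a p)%:R : R)^-1 <=
    (count (fun a' => slope p a' == slope p a) A)%:R^-1.
  move=> aA; rewrite lef_pV2 ?posrE ?ltr0n ?kappa_gt0 //; last first.
    by rewrite -has_count; apply/hasP; exists a.
  by rewrite ler_nat kappa_ge.
have neq a t : a \in A -> t \in G -> a != t by move=> aA tG; apply: contraNneq (GA tG) => <-.
have [<-|pq] := eqVneq p q.
  apply: (@le_trans _ _ (\sum_(a <- A)
      ((count (fun a' => slope p a' == slope p a) A)%:R : R)^-1)).
    rewrite big_seq [leRHS]big_seq; apply: ler_sum => a aA.
    by rewrite eqxx mul1r le_inv.
  rewrite sum_inv_multiplicity ler_nat; apply: leq_trans (leL pG).
  apply: uniq_leq_size; first exact: undup_uniq.
  move=> v; rewrite !mem_undup => /mapP[a aA ->]; apply: map_f.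
  by rewrite mem_filter neq // AS.
pose m := count (fun a => slope p a == slope p q) A.
apply: (@le_trans _ _ (\sum_(a <- A) (slope p a == slope p q)%:R * (m%:R : R)^-1)).
  rewrite big_seq [leRHS]big_seq; apply: ler_sum => a aA.
  have [e|_] := eqVneq (slope a p) (slope a q); last first.
    by rewrite mul0r mulr_ge0 // invr_ge0.
  have e' : slope p a = slope p q.
    rewrite slopeC; apply/esym.
    exact: (slope_trans (AS aA) pS qS (neq _ _ aA pG) (neq _ _ aA qG) pq e).
  by rewrite e' eqxx !mul1r; apply: le_trans (le_inv a aA) _; rewrite e'.
rewrite -big_distrl /= -natr_sum -count_sum -/m.
have [->|m0] := posnP m; first by rewrite mul0r.
by rewrite divff // pnatr_eq0 -lt0n.
Qed.

(** Cauchy-Schwarz in each pencil, lines being weighted by [kappa] because a pair on a rich line is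
    seen from many centres. The weighted count of pairs is at most [g * g + g * L], while a centre
    contributes on average at least a fixed fraction of [g * g / M]; since [size A] is at least
    [4 * M], [g] cannot exceed [L]. *)
Lemma dirac_ball : (0 < h)%N ->
    {in G, forall p, (r * \sum_(a <- A) gap a p <= size A * size S)%N} ->
    (4 * size S <= r * h.+1)%N -> (8 * (h + k) <= size A)%N ->
  (size G <= L)%N.
Proof.
move=> h0 near Sr hkA.
have [->//|g0] := posnP (size G).
have A0 : (0 < size A)%N by lia.
pose good (a p : pt) := (gap a p <= h)%N.
have good_ge p : p \in G -> (3 * size A <= 4 * count (good^~ p) A)%N.
  move=> pG.
  have S0 : (0 < size S)%N by case: (S) (GS pG).
  have bad4 : (4 * count (fun a => h < gap a p) A <= size A)%N.
    have lb : (h.+1 * count (fun a => h < gap a p) A <= \sum_(a <- A) gap a p)%N.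
      rewrite count_sum big_distrr /=; apply: leq_sum => a _.
      by case: ltnP => /= hb; rewrite ?muln1 ?muln0.
    rewrite -(@leq_pmul2r (size S)) //; apply: leq_trans (near p pG).
    apply: (@leq_trans (r * (h.+1 * count (fun a => h < gap a p) A))%N).
      by rewrite mulnA; move: Sr; nia.
    by rewrite leq_mul2l lb orbT.
  have : (size A = count (good^~ p) A + count (fun a => h < gap a p) A)%N.
    rewrite -(count_predC (good^~ p)); congr (_ + _)%N.
    by apply: eq_count => a; rewrite /= /good -ltnNge.
  by lia.
pose lev a := undup [seq slope a p | p <- G & good a p].
pose num a v := count (fun p => good a p && (slope a p == v)) G.
have num_sum a : (\sum_(v <- lev a) num a v = count (good a) G)%N.
  under eq_bigr => v _ do rewrite /num count_sum.
  rewrite exchange_big count_sum; apply: eq_big_seq => p pG /=.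
  have [gp|_] := boolP (good a p); last by rewrite /= big1.
  rewrite /= -count_sum (eq_count (a2 := pred1 (slope a p))) => [|v]; last exact: eq_sym.
  by rewrite count_uniq_mem ?undup_uniq // mem_undup map_f // mem_filter gp.
pose kap a v := count_mem v (slopes a).
have lev_rep a v : v \in lev a -> exists2 p, p \in G & good a p /\ v = slope a p.
  by rewrite mem_undup => /mapP[p]; rewrite mem_filter => /andP[gp pG] ->; exists p.
have kap_sum a : a \in A -> (\sum_(v <- lev a) kap a v <= (h + k).*2)%N.
  move=> aA; apply: (@window_weight R [seq slope a x | x <- S] (slopes a) (slope a c)).
  - exact: undup_uniq.
  - move=> P; rewrite /slopes !count_map count_filter; apply: sub_count => x /andP[].
    by [].
  - move=> v /lev_rep[p pG [_ ->]]; apply: (thin (AS aA) (GS pG)).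
    by apply: contraNneq (GA pG) => <-.
  - by move=> v /lev_rep[p pG [gp ->]].
pose M : R := ((h + k).*2)%:R; pose g : R := (size G)%:R.
have M0 : 0 < M by rewrite ltr0n double_gt0; lia.
have gp0 : 0 < g by rewrite ltr0n.
(* [amgm] is Cauchy-Schwarz in linear form, sharp where [x = th * y]; [g / M] is the ratio of the
   number of points to the weight bound. *)
pose th := g / M.
have th0 : 0 < th by rewrite divr_gt0.
have amgm (x y : R) : 0 < y -> 2 * x <= th * y + th^-1 * (x ^+ 2 / y).
  move=> y0; rewrite -subr_ge0.
  have -> : th * y + th^-1 * (x ^+ 2 / y) - 2 * x = (th * y - x) ^+ 2 / (th * y).
    by field; rewrite !gt_eqF.
  by rewrite divr_ge0 ?sqr_ge0 // mulr_ge0 // ltW.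
have sq_sum : \sum_(a <- A) \sum_(v <- lev a) (num a v)%:R ^+ 2 / (kap a v)%:R <=
    g * g + g * L%:R.
  apply: (@le_trans _ _ (\sum_(a <- A) \sum_(p <- G) \sum_(q <- G)
      (slope a p == slope a q)%:R / (kappa a p)%:R)).
    rewrite big_seq [leRHS]big_seq; apply: ler_sum => a aA.
    apply: (@le_trans _ _ (\sum_(v <- lev a) \sum_(p <- G) \sum_(q <- G)
        (slope a p == v)%:R * ((slope a p == slope a q)%:R / (kappa a p)%:R))).
      apply: ler_sum => v _; rewrite expr2 -mulrA {1}/num count_sum natr_sum big_distrl /=.
      apply: ler_sum => p _; rewrite /num count_sum natr_sum big_distrl big_distrr /=.
      apply: ler_sum => q _.
      have [/andP[_ /eqP pv]|_] := boolP (good a p && _); last first.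
        by rewrite mul0r !mulr_ge0 // invr_ge0.
      have [/andP[_ /eqP qv]|_] := boolP (good a q && _); last first.
        by rewrite mul0r mulr0 !mulr_ge0 // invr_ge0.
      by rewrite /kap pv qv eqxx !mul1r.
    rewrite exchange_big; apply: ler_sum => p _; rewrite exchange_big; apply: ler_sum => q _.
    rewrite -big_distrl /= -natr_sum -count_sum ler_piMl //.
      by rewrite mulr_ge0 // invr_ge0.
    rewrite lern1 (eq_count (a2 := pred1 (slope a p))) => [|v]; last exact: eq_sym.
    by rewrite count_uniq_mem ?undup_uniq // leq_b1.
  rewrite exchange_big; under eq_bigr => p _ do rewrite exchange_big.
  apply: (@le_trans _ _ (\sum_(p <- G) \sum_(q <- G) (1 + (p == q)%:R * L%:R))).
    rewrite big_seq [leRHS]big_seq; apply: ler_sum => p pG.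
    rewrite big_seq [leRHS]big_seq; apply: ler_sum => q qG.
    apply: le_trans (sum_inv_kappa pG qG) _.
    by case: eqP => _; rewrite ?mul1r ?mul0r ?addr0 ?lerDr.
  under eq_bigr => p _ do rewrite big_split -big_distrl /= -natr_sum -count_sum.
  rewrite big_split /=; apply: lerD.
    by rewrite !big_const_seq !count_predT !iter_addr !addr0 -mulr_natr.
  rewrite -big_distrl /= ler_wpM2r // -natr_sum ler_nat -[leqRHS]muln1 -sum_cst_seq.
  apply: leq_sum => p _; rewrite (eq_count (a2 := pred1 p)) => [|q]; last exact: eq_sym.
  by rewrite count_uniq_mem // leq_b1.
have I_le : 2 * \sum_(a <- A) (count (good a) G)%:R <=
    th * ((size A)%:R * M) + th^-1 * (g * g + g * L%:R).
  apply: (@le_trans _ _ (\sum_(a <- A) (th * M +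
      th^-1 * \sum_(v <- lev a) (num a v)%:R ^+ 2 / (kap a v)%:R))).
    rewrite big_distrr /= big_seq [leRHS]big_seq; apply: ler_sum => a aA.
    rewrite -num_sum natr_sum big_distrr /=.
    apply: (@le_trans _ _ (\sum_(v <- lev a)
        (th * (kap a v)%:R + th^-1 * ((num a v)%:R ^+ 2 / (kap a v)%:R)))).
      rewrite big_seq [leRHS]big_seq; apply: ler_sum => v /lev_rep[p pG [_ ->]].
      by apply: amgm; rewrite ltr0n kappa_gt0.
    rewrite big_split -!big_distrr /= lerD2r ler_pM2l // -natr_sum ler_nat.
    exact: kap_sum.
  rewrite big_split /=; apply: lerD; last by rewrite -big_distrr /= ler_pM2l ?invr_gt0.
  rewrite big_const_seq count_predT iter_addr addr0 -[(th * M) *+ _]mulr_natr.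
  by rewrite -mulrA [M * _]mulrC.
have I_ge : (3 * size A * size G <= 4 * \sum_(a <- A) count (good a) G)%N.
  under eq_bigr => a _ do rewrite count_sum.
  rewrite exchange_big big_distrr /= mulnC -sum_cst_seq; apply: leq_sum_seq_in => p pG.
  by rewrite -count_sum; apply: good_ge.
move: I_ge; rewrite -(ler_nat R) !natrM natr_sum -/g => I_ge.
have thM : th * ((size A)%:R * M) = (size A)%:R * g by rewrite /th; field; rewrite gt_eqF.
have thg : th^-1 * (g * g + g * L%:R) = M * (g + L%:R).
  by rewrite /th; field; rewrite !gt_eqF.
rewrite thM thg in I_le.
have MA : 4 * M <= (size A)%:R.
  by rewrite /M -natrM ler_nat; move: hkA; lia.
rewrite -(ler_nat R) -/g.
have A0' : 0 < ((size A)%:R : R) by rewrite ltr0n.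
have key : (size A)%:R * g <= (size A)%:R * L%:R.
  have L0 : 0 <= L%:R :> R by [].
  have : 4 * M * (g + L%:R) <= (size A)%:R * (g + L%:R).
    by rewrite ler_wpM2r // addr_ge0 // ltW.
  move: I_ge I_le; move: (\sum_(a <- A) _) ((size A)%:R : R) (L%:R : R) => I u v.
  by move: (g) (M) => x y; lra.
by rewrite ler_pM2l in key.
Qed.

End WeakDirac.

Lemma seq_argmax (T : eqType) (s : seq T) (f : T -> nat) : s != [::] ->
  exists2 a, a \in s & {in s, forall x, (f x <= f a)%N}.
Proof.
elim: s => // x [|y s] IHs _.
  by exists x; rewrite ?mem_head // => z; rewrite inE => /eqP->.
have [//|m ms mle] := IHs; have [xm|mx] := leqP (f x) (f m).
  exists m; first by rewrite inE ms orbT.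
  by move=> z; rewrite inE => /predU1P[->|/mle].
exists x; first exact: mem_head.
move=> z; rewrite inE => /predU1P[->//|/mle zm]; exact: leq_trans zm (ltnW mx).
Qed.

(* The left half of the points serves as pencil centres, the right half as
   points, so that slopes are monotone along each pencil. *)
Lemma weak_dirac : exists C : nat, forall (R : realType) (X Y : 'rV[R]_3 -> R)
    (S : seq 'rV[R]_3), poly_fun 1 X -> poly_fun 1 Y -> uniq S ->
    {in S &, injective X} -> (128 <= size S)%N ->
    {in S &, forall a x, a != x ->
      (count_mem (slope X Y a x) (slopes X Y S a) <= size S %/ 64)%N} ->
  exists2 a, a \in S & (size S <= C * size (undup (slopes X Y S a)))%N.
Proof.
have [C1 cover] := level_cover.
(* [256 = 4 * 64] ensures [4 * n <= r * h.+1] for [h = n %/ 64]. *)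
have [r rE] : exists r, r = 256%N by eexists.
exists (2 * (C1 * r ^ 3))%N => R X Y S pX pY uS X_inj n128 thin.
have S0 : S != [::] by case: S n128 {uS X_inj thin}.
have [a aS amax] := seq_argmax (fun a => size (undup (slopes X Y S a))) S0.
exists a => //; set L := size (undup (slopes X Y S a)).
set n := size S in n128 thin *.
pose S' := sort (fun x y => X x <= X y) S.
have S'S : S' =i S by apply: mem_sort.
have uS' : uniq S' by rewrite sort_uniq.
have sS' : size S' = n by rewrite size_sort.
pose A := take (n %/ 2) S'; pose P := drop (n %/ 2) S'.
have sA : size A = (n %/ 2)%N by rewrite size_takel // sS' leq_div.
have sP : size P = (n - n %/ 2)%N by rewrite size_drop sS'.
have AS : {subset A <= S} by move=> x /mem_take; rewrite S'S.
have PS : {subset P <= S} by move=> x /mem_drop; rewrite S'S.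
have uAP : uniq (A ++ P) by rewrite cat_take_drop.
have [uA uP] : uniq A /\ uniq P by move: uAP; rewrite cat_uniq => /and3P[].
have PA : {in P, forall p, p \notin A}.
  by move=> p pP; move: uAP; rewrite cat_uniq => /and3P[_ /hasPn/(_ p pP)].
have ltX : {in A & P, forall x p, X x < X p}.
  move=> x p xA pP; rewrite lt_neqAle; apply/andP; split.
    apply: contraNneq (PA p pP) => /(X_inj _ _ (AS x xA) (PS p pP)) <-; exact: xA.
  have : pairwise (fun x y => X x <= X y) (A ++ P).
    rewrite cat_take_drop -sorted_pairwise; last by move=> u v w; apply: le_trans.
    by apply: sort_sorted => u v; apply: le_total.
  by rewrite pairwise_cat => /and3P[/allrelP/(_ x p xA pP)].
have [||Z [ZP sZ cov]] := cover R _ A (fun a => [seq slope X Y a x | x <- S])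
    (slope X Y) P r _.
- by rewrite rE.
- move=> x th xA.
  (* A slope is a quotient, but after multiplication by [X p - X x], positive since [p] lies to the
     right of the centre, comparing it with [th] is a linear test. *)
  exists (fun p => (Y p + - th * X p) + (th * X x - Y x)).
    apply: poly_funD; last exact: poly_fun_const.
    by apply: poly_funS; apply: poly_funD => //; apply: poly_funZ.
  move=> p pP; have xp : 0 < X p - X x by rewrite subr_gt0 ltX.
  have -> : Y p + - th * X p + (th * X x - Y x) = (Y p - Y x) - th * (X p - X x) by ring.
  rewrite /slope subr_gt0 ltr_pdivlMr //; split=> //.
  by rewrite subr_eq0 -[RHS](inj_eq (mulIf (lt0r_neq0 xp))) mulfVK ?lt0r_neq0.
have sumE : (\sum_(a <- A) size [seq slope X Y a x | x <- S] = size A * n)%N.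
  by under eq_bigr => x _ do rewrite size_map; rewrite sum_cst_seq.
pose near c p := (r * \sum_(x <- A) level_gap [seq slope X Y x y | y <- S]
  (slope X Y x c) (slope X Y x p) <= size A * n)%N.
have groups : (size P <= size Z * L)%N.
  apply: leq_trans (@covered_size _ _ P Z near _) _.
    by move=> p pP; have [c cZ cp] := cov p pP; exists c => //; rewrite /near -sumE.
  rewrite -sum_cst_seq; apply: leq_sum_seq_in => c cZ; rewrite -size_filter.
  have fP (p : 'rV[R]_3) : p \in [seq p <- P | near c p] -> near c p /\ p \in P.
    by rewrite mem_filter => /andP[].
  apply: (@dirac_ball R X Y S uS X_inj A _ c (n %/ 64) (n %/ 64) r L uA AS) => //.
  - exact: filter_uniq.
  - by move=> p /fP[_ /PS].
  - by move=> p /fP[_ /PA].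
  - by move=> p /fP[_ /PS pS]; apply: amax.
  - by rewrite divn_gt0 //; clear -n128; lia.
  - by move=> p /fP[].
  - by rewrite rE -/n; clear -n128; lia.
  - by rewrite sA; clear -n128; lia.
have : (n <= 2 * size P)%N by rewrite sP; clear -n128; lia.
move/leq_trans; apply; apply: (@leq_trans (2 * (size Z * L))%N).
  by rewrite leq_mul2l groups.
by rewrite -[leqRHS]mulnA leq_mul2l leq_mul2r sZ !orbT.
Qed.

(** * Areas *)

Section Areas.
Variable R : realType.
Local Notation pt := 'rV[R]_3.

Lemma poly_nonroot (p : {poly R}) : p != 0 -> exists x, p.[x] != 0.
Proof.
move=> p0; pose rs : seq R := [seq i%:R | i <- iota 0 (size p)].
have [/hasP[x _ px]|/hasPn all0] := boolP (has (fun x => p.[x] != 0) rs); first by exists x.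
have urs : uniq rs by rewrite map_inj_uniq ?iota_uniq // => i j /eqP; rewrite eqr_nat => /eqP.
have : all (root p) rs by apply/allP => x /all0; rewrite negbK.
by move=> /(max_poly_roots p0) /(_ urs); rewrite size_map size_iota ltnn.
Qed.

(** On this curve a nonzero linear form is a nonzero polynomial in [t], so a generic vector only has
    to avoid finitely many roots. *)
Definition moment (t : R) : pt := \row_(i < 3) t ^+ i.

Lemma dot_moment t u : dot (moment t) u =
  ((u 0 0)%:P + (u 0 1) *: 'X + (u 0 2%:R) *: 'X^2).[t].
Proof.
have m0 : moment t 0 0 = 1 by rewrite mxE.
have m1 : moment t 0 1 = t by rewrite mxE.
have m2 : moment t 0 2%:R = t ^+ 2 by rewrite mxE.
rewrite dotE m0 m1 m2 !(hornerD, hornerZ, hornerX, hornerXn, hornerC); ring.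
Qed.

Lemma exists_generic_moment (us : seq pt) : 0 \notin us ->
  exists t, {in us, forall u, dot (moment t) u != 0}.
Proof.
move=> us0.
pose P (u : pt) : {poly R} := (u 0 0)%:P + (u 0 1) *: 'X + (u 0 2%:R) *: 'X^2.
have P0 u : u \in us -> P u != 0.
  move=> uin; apply: contraNneq us0 => e; suff <- : u = 0 by [].
  have c i : (P u)`_i = 0 by rewrite e coef0.
  apply: row3P; rewrite !coord_zero; have := (c 0%N, c 1%N, c 2%N).
  by rewrite !coefE /= ?mulr0 ?mulr1 ?addr0 ?add0r => -[[]].
have : \prod_(u <- us) P u != 0.
  by rewrite prodf_seq_neq0; apply/allP => u uin; rewrite P0 ?implybT.
move=> /poly_nonroot[t]; rewrite horner_prod prodf_seq_neq0 => /allP nz.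
by exists t => u /nz /=; rewrite dot_moment.
Qed.

Definition area_sq (a b x : pt) : R := axis_value (b - a) (x - a).

Definition area_sqs (S : seq pt) (a b : pt) : seq R :=
  undup [seq area_sq a b x | x <- S & area_sq a b x != 0].

Lemma poly_fun_dot (e : pt) : poly_fun 1 (dot e).
Proof. by apply: poly_fun_sum => i; apply/poly_funZ/poly_funX. Qed.

Lemma dotB (e u v : pt) : dot e (u - v) = dot e u - dot e v.
Proof. by rewrite !dotE !coordE; ring. Qed.

Lemma slope_dotE (e f a x : pt) :
  slope (dot e) (dot f) a x = dot f (x - a) / dot e (x - a).
Proof. by rewrite /slope !dotB. Qed.

Lemma axis_value_eq0 (b p : pt) : (axis_value b p == 0) = (cross_product b p == 0).
Proof. exact: dot_eq0. Qed.

(** A projection to the plane under which no new collinear triples arise. The slopes of [u] and [v]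
    agree exactly when [f] is orthogonal to [(u x v) x e]. If this vector vanished with
    [u x v != 0], then [e] would be parallel to [u x v], hence orthogonal to [u], which the choice
    of [e] excludes. *)
Lemma generic_slopes (S : seq pt) : uniq S -> exists e f : pt,
  {in S &, injective (dot e)} /\
  {in S & &, forall a x y, x != a -> y != a ->
    (slope (dot e) (dot f) a x == slope (dot e) (dot f) a y) =
    (cross_product (x - a) (y - a) == 0)}.
Proof.
move=> uS.
pose us := [seq u <- [seq x - a | x <- S, a <- S] | u != 0].
have usP x a : x \in S -> a \in S -> x != a -> x - a \in us.
  move=> xS aS xa; rewrite mem_filter subr_eq0 xa /=.
  exact: (allpairs_f (fun x a : pt => x - a)).
have [|t tP] := @exists_generic_moment us; first by rewrite mem_filter eqxx.
pose e := moment t.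
have eP x a : x \in S -> a \in S -> x != a -> dot e (x - a) != 0.
  move=> xS aS xa; apply: tP; exact: usP.
pose ws := [seq w <- [seq cross_product (cross_product u v) e | u <- us, v <- us] | w != 0].
have [|t' t'P] := @exists_generic_moment ws; first by rewrite mem_filter eqxx.
exists e, (moment t'); split.
  move=> x y xS yS xy; apply/eqP; apply: contraT => /(eP x y xS yS).
  by rewrite dotB xy subrr eqxx.
move=> a x y aS xS yS xa ya; rewrite !slope_dotE.
have eu := eP x a xS aS xa; have ev := eP y a yS aS ya.
set u := x - a in eu *; set v := y - a in ev *.
rewrite eqr_div // -subr_eq0.
have fE : dot (moment t') u * dot e v - dot (moment t') v * dot e u =
    - dot (moment t') (cross_product (cross_product u v) e).
  by rewrite !dotE !coordE; ring.
rewrite fE oppr_eq0; apply/idP/idP => [|/eqP uv0]; last first.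
  by rewrite uv0 dotE !coordE; apply/eqP; ring.
apply: contraLR => uv0; apply: t'P; rewrite mem_filter; apply/andP; split; last first.
  by apply: (allpairs_f (fun u v => cross_product (cross_product u v) e)); apply: usP.
apply/eqP => we; have /(cross_eq0P _ uv0)[k ek] : cross_product (cross_product u v) e == 0.
  by rewrite we.
move/eqP: eu; apply; rewrite ek !dotE !coordE; ring.
Qed.

Lemma size_le_double_image (T : eqType) (U : eqType) (M : seq T) (f : T -> U) :
    {in M, forall y, (count (fun y' => f y' == f y) M <= 2)%N} ->
  (size M <= 2 * size (undup [seq f y | y <- M]))%N.
Proof.
move=> le2; apply: leq_trans (@covered_size _ _ M (undup [seq f y | y <- M])
  (fun v y => f y == v) _) _.
  by move=> y yM; exists (f y) => //; rewrite mem_undup map_f.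
rewrite mulnC -sum_cst_seq; apply: leq_sum_seq_in => v.
by rewrite mem_undup => /mapP[y yM ->]; apply: le2.
Qed.

(** The height of [a + tau *: (x - a)] over the side [a p] is proportional to the absolute value of
    [tau], so an area occurs for at most two points of the line. *)
Lemma rich_line_areas (S M : seq pt) (a x p : pt) : uniq M -> {subset M <= S} ->
    x != a -> cross_product (p - a) (x - a) != 0 ->
    {in M, forall y, y != a /\ cross_product (x - a) (y - a) = 0} ->
  (size M <= 2 * size (area_sqs S a p))%N.
Proof.
move=> uM MS xa px line.
have d0 : x - a != 0 by rewrite subr_eq0.
have tauP y : y \in M -> exists2 tau, y = a + tau *: (x - a) & tau != 0.
  move=> /line[ya /eqP/(cross_eq0P _ d0)[tau e]]; exists tau.
    by rewrite -e addrC subrK.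
  apply: contra_neq ya => tau0; move/eqP: e; rewrite tau0 scale0r subr_eq0.
  by move/eqP.
have valE tau : area_sq a p (a + tau *: (x - a)) = tau ^+ 2 * area_sq a p x.
  rewrite /area_sq addrAC subrr add0r; move: (p - a) (x - a) => u v.
  by rewrite /axis_value !dotE !coordE; ring.
have px0 : area_sq a p x != 0 by rewrite axis_value_eq0.
apply: leq_trans (@size_le_double_image _ _ M (area_sq a p) _) _.
  move=> y yM; have [tau yE tau0] := tauP y yM.
  rewrite -size_filter.
  apply: (@uniq_leq_size _ _ [:: a + tau *: (x - a); a + (- tau) *: (x - a)]).
    exact: filter_uniq.
  move=> z; rewrite mem_filter => /andP[/eqP + zM]; have [tau' -> _] := tauP z zM.
  rewrite yE !valE => /(mulIf px0)/eqP; rewrite eqf_sqr !inE.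
  by case/orP => /eqP->; rewrite eqxx ?orbT.
rewrite leq_mul2l /=; apply: uniq_leq_size; first exact: undup_uniq.
move=> v; rewrite !mem_undup => /mapP[y yM ->]; apply: map_f.
rewrite mem_filter MS // andbT; have [tau -> tau0] := tauP y yM.
by rewrite valE mulf_neq0 // expf_neq0.
Qed.

End Areas.

(** * Many areas over a common side *)

Local Open Scope fset_scope.
Local Open Scope ring_scope.

Lemma many_area_sqs : exists C : nat, forall (R : realType) (S : seq 'rV[R]_3) (a0 b0 x0 : 'rV[R]_3),
    uniq S -> a0 \in S -> b0 \in S -> x0 \in S ->
    cross_product (b0 - a0) (x0 - a0) != 0 ->
  exists a b, [/\ a \in S, b \in S, a != b &
    (size S ^ 2 <= C * size (area_sqs S a b) ^ 3)%N].
Proof.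
have [C1 dirac] := weak_dirac; have [C2 levels] := axes_levels.
(* 128 covers both the small sets and the rich lines, where [size S %/ 64 < 2 * T]. *)
have [K KE] : exists K, K = 128%N by eexists.
exists (K ^ 2 + C1 ^ 2 * (C2 * 2 ^ 3))%N => R S a0 b0 x0 uS a0S b0S x0S nc.
pose prs := [seq ab <- [seq (a, b) | a <- S, b <- S] | ab.1 != ab.2].
have prsP a b : a \in S -> b \in S -> a != b -> (a, b) \in prs.
  by move=> aS bS ab; rewrite mem_filter /= ab; apply: allpairs_f.
have ab0 : a0 != b0.
  apply: contra_neq nc => ->; rewrite subrr; apply: row3P.
  by rewrite !coordE; split; ring.
have prs0 : prs != [::] by case: (prs) (prsP _ _ a0S b0S ab0).
(* The pair with most areas is fixed before the cases, so each case only has to exhibit some pair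
   with many. *)
have [[a b] abP Tmax] := seq_argmax (fun ab => size (area_sqs S ab.1 ab.2)) prs0.
have [ab aS bS] : [/\ a != b, a \in S & b \in S].
  by move: abP; rewrite mem_filter => /andP[/= -> /allpairsP[[x y] /= [xS yS [-> ->]]]].
exists a, b; split=> //; rewrite /= in Tmax.
set T := size (area_sqs S a b) in Tmax *.
have {}Tmax c d : c \in S -> d \in S -> c != d -> (size (area_sqs S c d) <= T)%N.
  by move=> cS dS cd; apply: (Tmax (c, d)); apply: prsP.
have T0 : (0 < T)%N.
  apply: leq_trans (Tmax _ _ a0S b0S ab0).
  have : area_sq a0 b0 x0 \in area_sqs S a0 b0.
    by rewrite mem_undup map_f // mem_filter axis_value_eq0 nc.
  by case: (area_sqs _ _ _).
have T3 : (T <= T ^ 3)%N by rewrite -[leqLHS]expn1 leq_pexp2l.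
have small X : (X <= K * T)%N -> (X ^ 2 <= (K ^ 2 + C1 ^ 2 * (C2 * 2 ^ 3)) * T ^ 3)%N.
  move=> XT; rewrite mulnDl; apply: leq_trans (leq_addr _ _).
  apply: (@leq_trans ((K * T) ^ 2)%N); first by rewrite leq_exp2r.
  by rewrite expnMn leq_mul2l leq_pexp2l ?orbT.
have [n128|n128] := ltnP (size S) 128.
  by apply: small; rewrite KE; apply: leq_trans (ltnW n128) _; apply: leq_pmulr.
have [e [f [e_inj slopeE]]] := generic_slopes uS.
pose sl := slope (dot e) (dot f); pose sls := slopes (dot e) (dot f) S.
have [/hasP[[c x] cxP rich]|/hasPn poor] :=
    boolP (has (fun cx => (size S %/ 64 < count_mem (sl cx.1 cx.2) (sls cx.1))%N) prs).
  have [cx cS xS] : [/\ c != x, c \in S & x \in S].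
    by move: cxP; rewrite mem_filter => /andP[/= -> /allpairsP[[u v] /= [uS' vS [-> ->]]]].
  pose M := [seq y <- S | (sl c y == sl c x) && (y != c)].
  have xc : x != c by rewrite eq_sym.
  have d0 : x - c != 0 by rewrite subr_eq0.
  have [p pS px] : exists2 p, p \in S & cross_product (p - c) (x - c) != 0.
    have [/hasP[p pS px]|/hasPn all0] :=
        boolP (has (fun p => cross_product (p - c) (x - c) != 0) S); first by exists p.
    have par p : p \in S -> exists k, p - c = k *: (x - c).
      move=> /all0; rewrite negbK => /eqP pe; apply/(cross_eq0P _ d0).
      by rewrite crossC pe oppr0.
    case/negP: nc; apply/eqP.
    have [k0 e0] := par _ a0S; have [k1 e1] := par _ b0S; have [k2 e2] := par _ x0S.
    have -> : b0 - a0 = (k1 - k0) *: (x - c).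
      by rewrite scalerBl -e1 -e0 opprB addrA subrK.
    have -> : x0 - a0 = (k2 - k0) *: (x - c).
      by rewrite scalerBl -e2 -e0 opprB addrA subrK.
    by apply: row3P; rewrite !coordE; split; ring.
  have cp : c != p.
    apply: contra_neq px => <-; rewrite subrr; apply: row3P.
    by rewrite !coordE; split; ring.
  have M_line : {in M, forall y, y != c /\ cross_product (x - c) (y - c) = 0}.
    move=> y; rewrite mem_filter => /andP[/andP[/eqP e1 yc] yS]; split=> //.
    by apply/eqP; rewrite -slopeE // -/sl e1.
  have sizeM : size M = count_mem (sl c x) (sls c).
    by rewrite /sls /slopes count_map count_filter size_filter.
  have MS : {subset M <= S} by move=> y; rewrite mem_filter => /andP[].
  have := rich_line_areas (filter_uniq _ uS) MS xc px M_line.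
  rewrite sizeM => le_M; have := Tmax _ _ cS pS cp.
  move: rich => /= rich leT; apply: small; rewrite KE.
  have : (size S %/ 64 < 2 * T)%N.
    by apply: leq_trans rich _; apply: leq_trans le_M _; rewrite leq_mul2l leT.
  by rewrite ltn_divLR // => /ltnW /leq_trans; apply; rewrite mulnAC.
have [|c cS Sc] := dirac R (dot e) (dot f) S (poly_fun_dot e) (poly_fun_dot f) uS e_inj n128.
  by move=> c x cS xS cx; have := poor (c, x) (prsP c x cS xS cx); rewrite /= -leqNgt.
rewrite -/(sls c) in Sc.
have reps (v : R) : exists x, v \in sls c -> [/\ x \in S, x != c & sl c x = v].
  have [/mapP[x]|_] := boolP (v \in sls c); last by exists c.
  by rewrite mem_filter => /andP[xc xS] ->; exists x.
have [rep repP] := choice reps.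
pose B := [seq rep v - c | v <- undup (sls c)].
have vP v : v \in undup (sls c) -> [/\ rep v \in S, rep v != c & sl c (rep v) = v].
  by rewrite mem_undup; apply: repP.
have sB : size B = size (undup (sls c)) by rewrite size_map.
have uB : uniq B.
  rewrite map_inj_in_uniq ?undup_uniq // => v w /vP[_ _ ev] /vP[_ _ ew] /addIr.
  by rewrite -{2}ev -{2}ew => ->.
have B0 : 0 \notin B.
  apply/mapP => -[v /vP[_ vc _] /esym/eqP]; rewrite subr_eq0; exact/negP.
have indep : {in B &, forall u v, u != v -> cross_product u v != 0}.
  move=> _ _ /mapP[v /vP[vS vc ev] ->] /mapP[w /vP[wS wc ew] ->] vw.
  rewrite -slopeE // -/sl ev ew; apply: contra_neq vw => ->; exact: erefl.
(* One more than [T]: points on the axis have the value 0, which [area_sqs] excludes. *)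
have leT : {in B, forall u, (size (axis_values B u) <= T.+1)%N}.
  move=> _ /mapP[v /vP[vS vc _] ->]; have cv : c != rep v by rewrite eq_sym.
  apply: (@leq_trans (size (0 :: area_sqs S c (rep v)))); last first.
    by rewrite /= ltnS Tmax.
  apply: uniq_leq_size; first exact: undup_uniq.
  move=> w; rewrite mem_undup => /mapP[_ /mapP[v' /vP[v'S _ _] ->] ->].
  rewrite inE; have [//|nz] := eqVneq.
  by rewrite mem_undup (map_f (area_sq c (rep v))) // mem_filter nz.
have := levels R B T.+1 uB B0 indep leT; rewrite sB => L2.
rewrite mulnDl; apply: leq_trans (leq_addl _ _).
apply: (@leq_trans ((C1 * size (undup (sls c))) ^ 2)%N); first by rewrite leq_exp2r.
rewrite expnMn -[leqRHS]mulnA leq_mul2l; apply/orP; right.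
apply: leq_trans L2 _; rewrite -[leqRHS]mulnA leq_mul2l -expnMn leq_exp2r //.
by rewrite mul2n -addnn -[leqLHS]add1n leq_add2r T0 orbT.
Qed.

(** * From squared areas to triangles *)

Section Final.
Variable R : realType.
Local Notation pt := 'rV[R]_3.

Lemma area3E (a b x : pt) : area3 a b x = Num.sqrt (area_sq a b x) / 2.
Proof.
by rewrite /area3 /euclidean_norm /area_sq /axis_value /dot.
Qed.

Lemma area_sqs_triangles (S : {fset pt}) (a b : pt) : a \in S -> b \in S -> a != b ->
  exists C : {fset {fset pt}},
    [/\ forall T, T \in C -> [/\ triangle S T, a \in T & b \in T],
        forall T, T \in C -> 0 < area T,
        forall T1 T2, T1 \in C -> T2 \in C -> T1 <> T2 -> area T1 <> area T2
      & #|` C| = size (area_sqs S a b)].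
Proof.
move=> aS bS ab; set V := area_sqs S a b.
have reps (v : R) : exists x, v \in V ->
    [/\ x \in S, area_sq a b x = v & area_sq a b x != 0].
  have [|_] := boolP (v \in V); last by exists a.
  rewrite mem_undup => /mapP[x]; rewrite mem_filter => /andP[nz xS] ->.
  by exists x.
have [rep repP] := choice reps.
pose tri v := [fset a; b; rep v].
have area_tri v : v \in V -> [/\ triangle S (tri v), area (tri v) = Num.sqrt v / 2 & 0 < v].
  move=> /repP[xS xv nz].
  have ax : a != rep v.
    apply: contra_neq nz => <-; apply/eqP; rewrite axis_value_eq0 subrr.
    by apply/eqP; apply: row3P; rewrite !coordE; split; ring.
  have bx : b != rep v.
    apply: contra_neq nz => <-; apply/eqP; rewrite axis_value_eq0.
    by apply/eqP; apply: row3P; rewrite !coordE; split; ring.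
  split.
  - split; first by apply/fsubsetP => y; rewrite !inE -orbA => /or3P[]/eqP->.
    by rewrite /tri fsetUC cardfsU1 cardfs2 !inE negb_or ab ![rep v == _]eq_sym ax bx.
  - by rewrite area_fset3 // area3E xv.
  - by rewrite -xv lt_neqAle eq_sym nz /area_sq /axis_value dot_ge0.
have area_inj v w : v \in V -> w \in V -> area (tri v) = area (tri w) -> v = w.
  move=> /area_tri[_ -> v0] /area_tri[_ -> w0].
  have h2 : (2 : R)^-1 != 0 by rewrite invr_eq0 pnatr_eq0.
  by move/(mulIf h2)/eqP; rewrite eqr_sqrt ?ltW // => /eqP.
exists [fset T in [seq tri v | v <- V]]; split.
- move=> T; rewrite inE /= => /mapP[v /area_tri[tv _ _] ->].
  by split=> //; rewrite !inE eqxx ?orbT.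
- move=> T; rewrite inE /= => /mapP[v /area_tri[_ av v0] ->].
  by rewrite av divr_gt0 // sqrtr_gt0.
- move=> T1 T2; rewrite !inE /= => /mapP[v vV ->] /mapP[w wV ->] ne e.
  by apply: ne; rewrite (area_inj v w).
- rewrite card_fseq undup_id ?size_map //.
  rewrite map_inj_in_uniq; first exact: undup_uniq.
  move=> v w vV wV e; exact: (area_inj v w vV wV (congr1 (@area R) e)).
Qed.

Lemma noncollinear_triple (S : {fset pt}) : (3 <= #|` S|)%N -> ~ collinear S ->
  exists a b x, [/\ a \in S, b \in S, x \in S & cross_product (b - a) (x - a) != 0].
Proof.
move=> S3 nc.
have [a [b [aS bS ab]]] : exists a b, [/\ a \in S, b \in S & a != b].
  have /fset0Pn[a aS] : S != fset0 by rewrite -cardfs_gt0; apply: leq_trans S3.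
  have /fset0Pn[b] : S `\ a != fset0.
    by move: S3; rewrite -cardfs_gt0 (cardfsD1 a) aS add1n ltnS; apply: leq_trans.
  by rewrite !inE => /andP[ba bS]; exists a, b; rewrite eq_sym.
have d0 : b - a != 0 by rewrite subr_eq0 eq_sym.
have [/hasP[x xS xP]|/hasPn all0] :=
    boolP (has (fun x => cross_product (b - a) (x - a) != 0) S).
  by exists a, b, x.
case: nc; exists a, (b - a); split=> // x /all0; rewrite negbK.
by move=> /(cross_eq0P _ d0)[t e]; exists t; rewrite -e addrC subrK.
Qed.

End Final.

Theorem theorem12 (R : realType) :
  exists c1 c2 : R, 0 < c1 /\ 0 < c2 /\
    forall (n : nat) (S : {fset 'rV[R]_3}),
      (3 <= n)%N -> #|` S| = n -> ~ collinear S ->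
      exists (a b : 'rV[R]_3) (C : {fset {fset 'rV[R]_3}}),
        [/\ a \in S, b \in S & a != b] /\
        [/\ forall T, T \in C -> [/\ triangle S T, a \in T & b \in T],
            forall T, T \in C -> 0 < area T,
            forall T1 T2, T1 \in C -> T2 \in C -> T1 <> T2 ->
              area T1 <> area T2
          & c1 * n%:R `^ (2%:R / 3%:R) / beta c2 n <= #|` C|%:R].
Proof.
have [K many] := many_area_sqs.
have K1 : 0 < K.+1%:R :> R by rewrite ltr0n.
(* The successor ensures positivity, and [K <= K.+1 ^ 3] lets the constant pass through the cube
   root. *)
exists (K.+1%:R^-1), 1; rewrite invr_gt0; split=> //; split=> // n S n3 Sn nc.
have [a0 [b0 [x0 [a0S b0S x0S nz]]]] := noncollinear_triple (eq_ind_r (leq 3) n3 Sn) nc.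
have [a [b [aS bS ab le_n]]] := many R S a0 b0 x0 (fset_uniq S) a0S b0S x0S nz.
have [C [C1 C2 C3 C4]] := area_sqs_triangles aS bS ab.
exists a, b, C; split=> //; split=> //; rewrite C4.
set m := size (area_sqs S a b) in le_n *.
have {}le_n : (n ^ 2 <= K * m ^ 3)%N by rewrite -Sn.
have beta1 : 1 <= beta (1 : R) n by rewrite /beta -expR0 ler_expR powR_ge0.
have nK : n%:R `^ (2%:R / 3%:R) <= K.+1%:R * m%:R :> R.
  have le3 : n%:R ^+ 2 <= (K.+1%:R * m%:R) ^+ 3 :> R.
    rewrite -natrM -!natrX ler_nat; apply: leq_trans le_n _.
    rewrite expnMn leq_mul2r; apply/orP; right; apply: leq_trans (leqnSn K) _.
    by rewrite -[leqLHS]expn1 leq_pexp2l.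
  have e3 : ((n%:R : R) `^ (2%:R / 3%:R)) ^+ 3 = n%:R ^+ 2.
    rewrite -powR_mulrn ?powR_ge0 // -powRrM.
    by rewrite divfK ?pnatr_eq0 // powR_mulrn.
  by rewrite -(ler_pXn2r (n := 3)) ?nnegrE ?powR_ge0 // ?e3 // mulr_ge0.
rewrite ler_pdivrMr ?(lt_le_trans ltr01) // mulrC ler_pdivrMr //.
apply: le_trans nK _; rewrite mulrC -mulrA ler_wpM2l // ler_peMl //.
Qed.
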